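(* Let $\mathcal{A}$ be a central hyperplane arrangement defined over a number field $K$, and let $\boldsymbol{\mu}=(\mu_x)_{x\in\mathcal{L}(\mathcal{A})}$ be a tuple of nonnegative integers. If $\mathfrak{o}$ is a compact discrete valuation ring and an $\mathcal{O}_K$-algebra with residue field $\mathbb{F}_q$ of size $q$ such that $\mathcal{A}$ has good reduction over $\mathbb{F}_q$, then $$\zeta^{\mathrm{ask}}_{\boldsymbol{\mu}_{\mathcal{A}}/\mathfrak{o}}(s)=\mathsf{mfHP}_{\mathcal{A}}\Big(-q^{-1},\big(q^{-s}\,q^{\dim(\mathcal{A})-\mathrm{rk}(y)-\sum_{x\not\le y}\mu_x}\big)_{y\in\mathcal{L}(\mathcal{A})}\Big).$$
   Context: Arrangements. A hyperplane arrangement $\mathcal{A}$ over a field $K$ is a finite set of affine hyperplanes in $K^{d}$, $d=\dim(\mathcal{A})$. Its intersection poset $\mathcal{L}(\mathcal{A})$ consists of all non-empty intersections of hyperplanes of $\mathcal{A}$ together with $\hat 0=K^d$, ordered by reverse inclusion and ranked by codimension, $\mathrm{rk}$; $\mathcal{A}$ is central if $\bigcap_{H\in\mathcal{A}}H\neq\varnothing$. For a number field $K$ with ring of integers $\mathcal{O}_K$, each $H\in\mathcal{A}$ is given as the zero locus of a fixed polynomial $L_H\in\mathcal{O}_K[X_1,\dots,X_d]$ of degree one; for central $\mathcal{A}$ the $L_H$ are taken to be homogeneous linear forms. Polynomials over $\mathcal{O}_K$ are viewed over an $\mathcal{O}_K$-algebra $\mathfrak{o}$ via the structure map. If $\mathfrak{p}$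 is the maximal ideal of $\mathfrak{o}$ and $\mathbb{F}_q=\mathfrak{o}/\mathfrak{p}$, then $\mathcal{A}$ has good reduction over $\mathbb{F}_q$ if $\mathcal{L}(\mathcal{A})\simeq\mathcal{L}(\mathcal{A}(\mathfrak{o}/\mathfrak{p}))$, where $\mathcal{A}(\mathfrak{o}/\mathfrak{p})$ is the arrangement over $\mathbb{F}_q$ obtained by reducing the $L_H$ modulo $\mathfrak{p}$. For $x\in\mathcal{L}(\mathcal{A})$ put $\mathcal{A}_x=\{H\in\mathcal{A}:H\supseteq x\}$, and let $\mathcal{A}^x=\{H\cap x: H\in\mathcal{A}\setminus\mathcal{A}_x,\ H\cap x\neq\varnothing\}$, an arrangement in $x$; set $\mathcal{A}_{\varnothing}=\mathcal{A}$ and $\mathcal{A}_x^y=(\mathcal{A}_x)^y$ for $y\le x$. Matrix of linear forms. Let $E=\{(x,i): x\in\mathcal{L}(\mathcal{A}),\ 1\le i\le\mu_x\}$ and let $Z_{(H,e)}$, for $e=(x,i)\in E$ and $H\in\mathcal{A}_x$, be algebraically independent variables. The matrix $A^{\boldsymbol{\mu}}_{\mathcal{A}}(\boldsymbol{Z})$ is the $d\times|E|$ matrix of linear forms whose entry at $(j,e)$, with $1\le j\le d$ and $e=(x,i)$, is $\sum_{H\in\mathcal{A}_x}L_H(e_j)Z_{(H,e)}$, where $e_1,\dots,e_d$ is the standard basis. Ask zeta function. For a $d\times e$ matrix $A$ of linear forms in $n$ variables over a ring $R$ and a finite $R$-algebra $S$, $\mathrm{ask}_S(A)=|S|^{-n}\sum_{z\in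 S^n}|\ker A(z)|$, where $A(z)$ acts on rows: $\ker A(z)=\{v\in S^d: v^{\top}A(z)=0\}$. For a compact discrete valuation ring $\mathfrak{o}$ with maximal ideal $\mathfrak{p}$ and residue field $\mathfrak{o}/\mathfrak{p}=\mathbb{F}_q$ of size $q$, and a matrix $A$ of linear forms over $\mathfrak{o}$, $\zeta^{\mathrm{ask}}_{A/\mathfrak{o}}(s)=\sum_{k\ge0}\mathrm{ask}_{\mathfrak{o}/\mathfrak{p}^k}(A)q^{-ks}$, where $s$ is a complex variable. Write $\zeta^{\mathrm{ask}}_{\boldsymbol{\mu}_{\mathcal{A}}/\mathfrak{o}}(s)=\zeta^{\mathrm{ask}}_{A^{\boldsymbol{\mu}}_{\mathcal{A}}/\mathfrak{o}}(s)$. Truncated flag Hilbert–Poincaré series. The Poincaré polynomial is $\pi_{\mathcal{A}}(t)=\sum_{x\in\mathcal{L}(\mathcal{A})}\mu(x)(-t)^{\mathrm{rk}(x)}$, with $\mu(x)=\mu(\hat 0,x)$ the Möbius function of $\mathcal{L}(\mathcal{A})$ (so the empty arrangement has Poincaré polynomial $1$). $\Delta(\mathcal{L}(\mathcal{A}))$ is the set of flags (chains) $F=(x_1<\dots<x_l)$ in $\mathcal{L}(\mathcal{A})$, including the empty flag. Put $\pi_F(X)=\prod_{i=0}^{l}\pi_{\mathcal{A}_{x_{i+1}}^{x_i}}(X)$ with $x_0=\hat 0$, $x_{l+1}=\varnothing$. Let $\min(F)=x_1$ for non-empty $F$ and $\min(\varnothing)=\varnothing$, and set $\underline{\pi}_F(X)=\pi_F(X)/\pi_{\mathcal{A}_{\min(F)}}(X)\in\mathbb{Z}[X]$.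 Then $\mathsf{mfHP}_{\mathcal{A}}(X,(T_x)_{x\in\mathcal{L}(\mathcal{A})})=\sum_{F\in\Delta(\mathcal{L}(\mathcal{A}))}\underline{\pi}_F(X)\prod_{x\in F}\frac{T_x}{1-T_x}$. *)

(* Defs.v *)
From HB Require Import structures.
From mathcomp Require Import all_boot all_order all_algebra all_field finmap.
From mathcomp Require Import all_classical all_reals all_analysis.
From mathcomp Require Import complex.

Set Implicit Arguments.
Unset Strict Implicit.
Unset Printing Implicit Defensive.

Import Order.TTheory GRing.Theory Num.Theory.
Import numFieldNormedType.Exports.

Local Open Scope ring_scope.

Section RingOfIntegers.
Variable K : fieldExtType rat.

Definition integer_pred : {pred K} :=
  fun x => `[< integralOver (intr : int -> K) x >].

Lemma integer_pred_subring : GRing.subring_closed integer_pred.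
Proof.
split=> [|x y /asboolP hx /asboolP hy|x y /asboolP hx /asboolP hy]; apply/asboolP.
- exact: integral1.
- exact: integral_sub.
- exact: integral_mul.
Qed.

HB.instance Definition _ :=
  GRing.isSubringClosed.Build K integer_pred integer_pred_subring.

Record ring_of_integers := RingOfIntegers {
  integer_val :> K;
  integer_valP : integer_val \in integer_pred }.

HB.instance Definition _ := [isSub for integer_val].
HB.instance Definition _ := [Choice of ring_of_integers by <:].
HB.instance Definition _ := [SubChoice_isSubComNzRing of ring_of_integers by <:].

End RingOfIntegers.

Section Mobius.
Variables (disp : Order.disp_t) (T : finPOrderType disp).
Local Open Scope order_scope.

(* The fuel [n] is never exhausted when it starts at [#|T|], see [mobiusE]. *)
Fixpoint mobius_rec (n : nat) (x y : T) : int :=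
  if x == y then 1
  else if n is n'.+1 then - \sum_(z | x <= z < y) mobius_rec n' x z else 0.

Definition mobius (x y : T) : int := mobius_rec #|T| x y.

Let below (y : T) := #|[pred z | z < y]|.

Lemma mobius_rec_fuel n m x y :
  (below y <= n)%N -> (below y <= m)%N -> mobius_rec n x y = mobius_rec m x y.
Proof.
have lt_below z t : z < t -> (below z < below t)%N.
  move=> zt; apply: proper_card; apply/properP; split.
    by apply/fintype.subsetP => u; rewrite !inE => /lt_trans; apply.
  by exists z; rewrite !inE ?ltxx.
elim: n m y => [|n IH] [|m] y //=; case: eqVneq => // _.
- rewrite leqn0 => /eqP y0 _; rewrite big1 ?oppr0 // => z /andP[_ /lt_below].
  by rewrite y0.
- move=> _; rewrite leqn0 => /eqP y0; rewrite big1 ?oppr0 //.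
  by move=> z /andP[_ /lt_below]; rewrite y0.
- move=> yn ym; congr (- _); apply: eq_bigr => z /andP[_ /lt_below zy].
  by apply: IH; rewrite -ltnS; apply: leq_trans zy _.
Qed.

Lemma mobiusE x y :
  mobius x y = if x == y then 1 else - \sum_(z | x <= z < y) mobius x z.
Proof.
have yT : (below y <= #|T|)%N by apply: max_card.
by rewrite /mobius (mobius_rec_fuel x yT (leqW yT)).
Qed.

End Mobius.

Section Arrangements.
Variables (F : fieldType) (d : nat).
Local Notation V := 'rV[F]_d.
Implicit Types (U x : {vspace V}) (A : {fset {vspace V}}).
Local Open Scope fset_scope.

(* As the hyperplanes are cut out by linear forms, all flats are linear        *)
(* subspaces; in particular every intersection contains 0, is non-empty, and   *)
(* the arrangement is central.  Restrictions live in a flat instead of F^d,    *)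
(* whence the ambient space U.                                                 *)

Definition zero_locus (l : 'cV[F]_d) : {vspace V} :=
  lker (linfun (mulmxr l : V -> 'M[F]_1)).

Lemma zero_locusP l (v : V) : (v \in zero_locus l) = (v *m l == 0).
Proof. by rewrite memv_ker lfunE. Qed.

Definition arrangement_in U A : Prop :=
  forall H, H \in A -> (H <= U)%VS /\ (\dim H).+1 = \dim U.

Definition intersections U A : {fset {vspace V}} :=
  [fset (U :&: \bigcap_(H <- enum_fset B) H)%VS | B : {fset {vspace V}} in fpowerset A].

Definition intposet U A : Type := intersections U A.

Definition flat_space U A (x : intposet U A) : {vspace V} := fsval x.

Lemma ambient_subproof U A : U \in intersections U A.
Proof.
apply/imfsetP; exists fset0; first by rewrite /= fpowersetE fsub0set.
by rewrite big_nil capvf.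
Qed.

Definition flat0 U A : intposet U A := FSetSub (ambient_subproof U A).

Definition localization A x : {fset {vspace V}} := [fset H in A | (x <= H)%VS].

Definition restriction A x : {fset {vspace V}} :=
  [fset (H :&: x)%VS | H in A `\` localization A x].

End Arrangements.

Section IntersectionPoset.
Variables (F : fieldType) (d : nat) (U : {vspace 'rV[F]_d}).
Variable A : {fset {vspace 'rV[F]_d}}.
Local Notation L := (intposet U A).

HB.instance Definition _ := Finite.copy L (intersections U A).

Fact intposet_display : Order.disp_t. Proof. exact: (Order.Disp tt tt). Qed.

Definition flat_le : rel L := fun x y => (flat_space y <= flat_space x)%VS.

Lemma flat_le_refl : reflexive flat_le.
Proof. by move=> x; apply: subvv. Qed.

Lemma flat_le_anti : antisymmetric flat_le.
Proof.
move=> x y /andP[yx xy]; apply: val_inj; apply/eqP.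
by rewrite eqEsubv; apply/andP; split.
Qed.

Lemma flat_le_trans : transitive flat_le.
Proof. by move=> y x z yx zy; apply: subv_trans zy yx. Qed.

HB.instance Definition _ := Order.Le_isPOrder.Build intposet_display L
  flat_le_refl flat_le_anti flat_le_trans.

Definition rk (x : L) : nat := (\dim U - \dim (flat_space x))%N.

Definition poincare : {poly int} :=
  \sum_(x : L) (mobius (flat0 U A) x)%:P * (- 'X) ^+ rk x.

End IntersectionPoset.

Section FlagSeries.
Variables (F : fieldType) (d : nat) (A : {fset {vspace 'rV[F]_d}}).
Local Notation L := (intposet fullv A).
Implicit Types (f : seq L) (i : nat).

(* [None] stands for the empty set, with A_emptyset = A. *)
Definition localization_opt (x : option L) : {fset {vspace 'rV[F]_d}} :=
  if x is Some x then localization A (flat_space x) else A.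

Definition flag_lower f i : L := nth (flat0 fullv A) (flat0 fullv A :: f) i.
Definition flag_upper f i : option L := nth None (map Some f) i.

Definition poincare_flag f : {poly int} :=
  \prod_(i < (size f).+1)
    poincare (flat_space (flag_lower f i))
      (restriction (localization_opt (flag_upper f i))
                   (flat_space (flag_lower f i))).

Definition flag_min f : option L := ohead f.

(* The division is exact.  It is carried out over the rationals since [%/] is  *)
(* only a pseudo-division for polynomials over int.                            *)
Definition poincare_flag_red f : {poly rat} :=
  map_poly intr (poincare_flag f)
    %/ map_poly intr (poincare fullv (localization_opt (flag_min f))).

(* A flag is a strictly increasing sequence; its length is at most #|L|. *)
Definition mfHP (C : fieldType) (X : C) (T : L -> C) : C :=
  \sum_(l < #|{: L}|.+1) \sum_(f : l.-tuple L | sorted <%O f)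
    (map_poly ratr (poincare_flag_red f)).[X] * \prod_(x <- f) (T x / (1 - T x)).

End FlagSeries.

Section AskMatrix.
Variables (F : fieldType) (d : nat) (A : {fset {vspace 'rV[F]_d}}).
Variables (R : comNzRingType) (L : A -> 'cV[R]_d).
Variable mu : intposet fullv A -> nat.

Definition col_index : Type := {x : intposet fullv A & 'I_(mu x)}.

HB.instance Definition _ :=
  Finite.copy col_index {x : intposet fullv A & 'I_(mu x)}.

Definition var_index : Type :=
  {v : A * col_index |
    fsval v.1 \in localization A (flat_space (tag v.2))}.

HB.instance Definition _ := Finite.copy var_index
  {v : A * col_index | fsval v.1 \in localization A (flat_space (tag v.2))}.

(* Linear forms over R in variables indexed by I are encoded by their          *)
(* coefficients, as elements of the free module {ffun I -> R^o}.                *)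
Definition ask_var (v : var_index) : {ffun var_index -> R^o} :=
  [ffun w => (w == v)%:R].

Definition ask_matrix : 'M[{ffun var_index -> R^o}]_(d, #|{: col_index}|) :=
  \matrix_(j < d, c < #|{: col_index}|)
    \sum_(v : var_index | (val v).2 == enum_val c)
      L (val v).1 j 0 *: ask_var v.

End AskMatrix.

Section Ask.
Local Open Scope classical_set_scope.

Definition base_change (R S : comPzRingType) (phi : R -> S) (I : finType) m n
    (M : 'M[{ffun I -> R^o}]_(m, n)) : 'M[{ffun I -> S^o}]_(m, n) :=
  map_mx (fun l : {ffun I -> R^o} => [ffun i => (phi (l i) : S^o)]) M.

Definition specialize (S : comPzRingType) (I : finType) m n
    (M : 'M[{ffun I -> S^o}]_(m, n)) (z : {ffun I -> S}) : 'M[S]_(m, n) :=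
  map_mx (fun l : {ffun I -> S^o} => \sum_i l i * z i) M.

Definition card_set (T : choiceType) (E : set T) : nat := #|` fset_set E |%fset.

(* [S] is an R-algebra via [phi], and is meant to be finite. *)
Definition ask (R S : comPzRingType) (phi : R -> S) (I : finType) m n
    (M : 'M[{ffun I -> R^o}]_(m, n)) : rat :=
  ((card_set [set: S])%:R ^+ #|I|)^-1 *
  \sum_(z \in [set: {ffun I -> S}])
    ((card_set [set v : 'rV[S]_m | v *m specialize (base_change phi M) z = 0])%:R
     : rat).

End Ask.

Section DVR.
Variable o : idomainType.
Local Open Scope classical_set_scope.

Definition is_ideal (I : set o) : Prop :=
  [/\ I 0, forall x y, I x -> I y -> I (x + y) & forall a x, I x -> I (a * x)].

Definition max_ideal : set o := [set x | x \isn't a GRing.unit].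

Definition is_dvr : Prop :=
  [/\ forall I, is_ideal I -> exists g, I = [set a * g | a in [set: o]],
      forall x y, max_ideal x -> max_ideal y -> max_ideal (x + y)
    & exists2 x, max_ideal x & x != 0].

Definition ideal_mul (I J : set o) : set o :=
  smallest is_ideal [set x | exists a b, [/\ I a, J b & x = a * b]].

Fixpoint max_pow (k : nat) : set o :=
  if k is k'.+1 then ideal_mul max_ideal (max_pow k') else [set: o].

Lemma max_pow_ideal k : is_ideal (max_pow k).
Proof.
case: k => [//|k] /=; split.
- by move=> N [[N0 _ _] _].
- by move=> x y Ix Iy N [iN sN]; case: (iN) => _ ND _; apply: ND;
     [apply: Ix | apply: Iy].
- by move=> a x Ix N [iN sN]; case: (iN) => _ _ NM; apply: NM; apply: Ix.
Qed.

Lemma max_pow_le k l : (k <= l)%N -> max_pow l `<=` max_pow k.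
Proof.
move=> /subnK <-; elim: (l - k)%N => [//|m IH] x /= Hx.
apply: IH; apply: Hx; split; first exact: max_pow_ideal.
move=> y [a [b [_ Jb ->]]].
by case: (max_pow_ideal (m + k)) => _ _; apply.
Qed.

(* o with the topology in which the powers of the maximal ideal form a basis   *)
(* of neighbourhoods of 0. *)
Definition adic : Type := o.

HB.instance Definition _ := Choice.on adic.

Definition adic_open (E : set adic) : Prop :=
  forall x : o, E x -> exists k, forall y : o, max_pow k (y - x) -> E y.

Lemma adic_openT : adic_open setT.
Proof. by move=> x _; exists 0. Qed.

Lemma adic_openI : setI_closed adic_open.
Proof.
move=> D E oD oE x [/oD[k Dk] /oE[l El]]; exists (maxn k l) => y Hy; split.
- by apply: Dk; apply: max_pow_le Hy; rewrite leq_maxl.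
- by apply: El; apply: max_pow_le Hy; rewrite leq_maxr.
Qed.

Lemma adic_open_bigU (I : Type) (f : I -> set adic) :
  (forall i, adic_open (f i)) -> adic_open (\bigcup_i f i).
Proof.
move=> fo x [i _ fx]; have [k Hk] := fo i x fx.
by exists k => y Hy; exists i => //; apply: Hk.
Qed.

HB.instance Definition _ :=
  isOpenTopological.Build adic adic_openT adic_openI adic_open_bigU.

Definition is_compact_dvr : Prop := is_dvr /\ compact [set: adic].

End DVR.

Section ResidueRing.
Variables (o : idomainType) (k : nat).
Local Open Scope quotient_scope.

Definition max_pow_pred : {pred o} := fun x => `[< max_pow k x >].

Lemma max_pow_zmod : zmod_closed max_pow_pred.
Proof.
have [I0 ID IM] := @max_pow_ideal o k.
split=> [|x y /asboolP hx /asboolP hy]; apply/asboolP => //.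
by apply: ID => //; rewrite -mulN1r; apply: IM.
Qed.

HB.instance Definition _ := GRing.isZmodClosed.Build o max_pow_pred max_pow_zmod.

Lemma max_pow_mul a x : x \in max_pow_pred -> a * x \in max_pow_pred.
Proof.
move=> /asboolP hx; apply/asboolP.
by have [_ _ IM] := @max_pow_ideal o k; apply: IM.
Qed.

(* The library puts a ring structure on quotients by proper ideals only; here  *)
(* the case k = 0 of the trivial ring is needed too.                           *)
Definition residue_ring : Type := {ideal_quot max_pow_pred}.

HB.instance Definition _ := GRing.Zmodule.copy residue_ring {ideal_quot max_pow_pred}.
HB.instance Definition _ := EqQuotient.copy residue_ring {ideal_quot max_pow_pred}.

Definition residue_map (x : o) : residue_ring := \pi_residue_ring x.

Lemma residue_mapE x y :
  (residue_map x == residue_map y) = (x - y \in max_pow_pred).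
Proof. by rewrite -Quotient.equivE eqquotE. Qed.

Lemma residue_mapK (x : residue_ring) : residue_map (repr x) = x.
Proof. exact: reprK. Qed.

Lemma residue_mapB : {morph residue_map : x y / x - y}.
Proof.
exact: (@pi_is_zmod_morphism _ _ _ {ideal_quot max_pow_pred}).
Qed.

Definition residue_mul (x y : residue_ring) : residue_ring :=
  residue_map (repr x * repr y).

Lemma residue_mapM x y :
  residue_map (x * y) = residue_mul (residue_map x) (residue_map y).
Proof.
apply/eqP; rewrite residue_mapE.
set x' := repr _; set y' := repr _.
have hx : x - x' \in max_pow_pred by rewrite -residue_mapE residue_mapK.
have hy : y - y' \in max_pow_pred by rewrite -residue_mapE residue_mapK.
have -> : x * y - x' * y' = y * (x - x') + x' * (y - y').
  by rewrite !mulrBr [y * x]mulrC [y * x']mulrC addrA subrK.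
by rewrite rpredD ?max_pow_mul.
Qed.

Lemma residue_mulA : associative residue_mul.
Proof.
move=> x y z; rewrite -(residue_mapK x) -(residue_mapK y) -(residue_mapK z).
by rewrite -!residue_mapM mulrA.
Qed.

Lemma residue_mulC : commutative residue_mul.
Proof. by move=> x y; rewrite /residue_mul mulrC. Qed.

Lemma residue_mul1 : left_id (residue_map 1) residue_mul.
Proof. by move=> x; rewrite -(residue_mapK x) -residue_mapM mul1r. Qed.

HB.instance Definition _ :=
  GRing.isZmodMorphism.Build o residue_ring residue_map residue_mapB.

Lemma residue_mulDl : left_distributive residue_mul +%R.
Proof.
move=> x y z; rewrite -(residue_mapK x) -(residue_mapK y) -(residue_mapK z).
by rewrite -raddfD -!residue_mapM mulrDl raddfD.
Qed.

HB.instance Definition _ := GRing.Zmodule_isComPzRing.Build residue_ring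
  residue_mulA residue_mulC residue_mul1 residue_mulDl.

Lemma residue_map_monoid : monoid_morphism residue_map.
Proof. by split=> // x y; apply: residue_mapM. Qed.

HB.instance Definition _ :=
  GRing.isMonoidMorphism.Build o residue_ring residue_map residue_map_monoid.

End ResidueRing.

Definition is_residue_field (o : idomainType) (Fq : fieldType)
    (red : {rmorphism o -> Fq}) : Prop :=
  (forall y, exists x, red x = y) /\ (forall x, red x = 0 <-> max_ideal x).

(* A form L_H reducing to 0 contributes the whole space to the reduced         *)
(* arrangement, hence no atom to its intersection poset.  Comparing the number *)
(* of atoms, an isomorphism forces the reduced forms to be non-zero and to     *)
(* define pairwise distinct hyperplanes.                                       *)
Definition good_reduction (K Fq : fieldType) (d : nat)
    (A : {fset {vspace 'rV[K]_d}}) (R : comNzRingType)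
    (L : A -> 'cV[R]_d) (red : {rmorphism R -> Fq}) : Prop :=
  exists2 f : intposet fullv A ->
              intposet fullv [fset zero_locus (map_mx red (L H)) | H : A]%fset,
    bijective f & {mono f : x y / (x <= y)%O}.

Section Zeta.
Variable R : realType.
Local Notation C := R[i].

Definition cexp (z : C) : C :=
  (expR (complex.Re z))%:C%C * Complex (cos (complex.Im z)) (sin (complex.Im z)).

Definition natpow (q : nat) (z : C) : C := cexp (z * (ln q%:R)%:C%C).

(* C^o is C with the topology given by its norm. *)
Definition zeta_ask_term (o : idomainType) (I : finType) m n
    (M : 'M[{ffun I -> o^o}]_(m, n)) (q : nat) (s : C) (k : nat) : C^o :=
  ratr (ask (@residue_map o k) M) * natpow q (- (k%:R * s)).

Definition zeta_ask_cvg (o : idomainType) (I : finType) m n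
    (M : 'M[{ffun I -> o^o}]_(m, n)) (q : nat) (s : C) : Prop :=
  cvgn (series (zeta_ask_term M q s)).

Definition zeta_ask (o : idomainType) (I : finType) m n
    (M : 'M[{ffun I -> o^o}]_(m, n)) (q : nat) (s : C) : C :=
  limn (series (zeta_ask_term M q s)).

End Zeta.

(* Main.v *)
From HB Require Import structures.
Require Import Defs.
From mathcomp Require Import all_boot all_order all_algebra all_field finmap.
From mathcomp Require Import all_classical all_reals all_analysis.
From mathcomp Require Import complex.
From mathcomp Require Import zify ring.

(* Summing over kernels first, ask over o/p^k becomes the sum over v of the
   inverse sizes of the images of z |-> v A(z).  These images are products of the
   ideals generated by the L_H(v), for H containing a flat x, each taken mu_x
   times.  Let y_j(v) be the flat cut out by the H with L_H(v) in p^j.  The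
   contribution of v is the product over j = 1, ..., k of q to the minus sum of
   the mu_x over the x not below y_j(v).  By good reduction the vectors v with a
   given weakly decreasing sequence y_1 >= ... >= y_k are counted, digit by digit,
   by the strata of the reductions of the arrangements A_(y_j), and Moebius
   inversion gives the number of points of the stratum of z in A_y as q^(dim z)
   times the Poincare polynomial of A_y^z at -1/q.  Hence the sums a_k(z) over all
   v with y_k(v) = z satisfy a linear triangular recursion in k.  Summed over k,
   it is the recursion of the flag series obtained by removing the least element
   of a flag. *)

Set Implicit Arguments.
Unset Strict Implicit.
Unset Printing Implicit Defensive.

Import Order.TTheory GRing.Theory Num.Theory.
Import numFieldNormedType.Exports.

Local Open Scope ring_scope.

(** * Minors and common zeros of linear forms *)

(** Good reduction is a mere isomorphism of posets, whereas counting digits needs control of the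
    forms themselves: a dependence over K must become one over o in which the dependent form has a
    unit coefficient, and independent forms must take arbitrary residues. Both follow once every set
    of forms has the same rank over K and over F_q, so this is what is extracted from the
    isomorphism; minors with entries in O_K carry the information between the two fields. On the
    analytic side, mfHP contains the quotients T/(1-T), which are 0 by convention at a pole, and the
    identity is claimed at every s where the series converges, where only the sum over all flats is
    known to converge. Positivity resolves both difficulties: the part of each flat is a
    non-negative rational times the same power of q^(-s), so nothing cancels between flats and each
    part can be summed separately. *)

Lemma dim_rowvf (F : fieldType) (n : nat) : \dim {:'rV[F]_n} = n.
Proof. by rewrite dimvf /dim /= mul1n. Qed.

Lemma dim_lker_mulmxr (F : fieldType) (m n : nat) (N : 'M[F]_(m, n)) :
  (\dim (lker (linfun (mulmxr N : 'rV[F]_m -> 'rV[F]_n))) + \rank N)%N = m.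
Proof.
set f := linfun _; pose B := row_base (kermx N).
pose g := linfun (mulmxr B : 'rV[F]_(\rank (kermx N)) -> 'rV[F]_m).
have -> : lker f = (g @: fullv)%VS.
  apply/eqP; rewrite eqEsubv; apply/andP; split; apply/subvP => v.
    rewrite memv_ker lfunE /= => /eqP vN.
    have /submxP[w ->] : (v <= B)%MS by rewrite eq_row_base; apply/sub_kermxP.
    by rewrite (_ : w *m B = g w) ?memv_img ?memvf // lfunE.
  move=> /memv_imgP[w _ ->]; rewrite memv_ker !lfunE /= -mulmxA.
  have /sub_kermxP -> : (B <= kermx N)%MS by rewrite eq_row_base.
  by rewrite mulmx0.
have Bfree : row_free B by apply: row_base_free.
have kg : (fullv :&: lker g)%VS = 0%VS.
  apply/eqP; rewrite -subv0; apply/subvP => v; rewrite memv_cap memv_ker lfunE /=.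
  rewrite memvf memv0 => /eqP vB; apply/eqP/(row_free_inj Bfree).
  by rewrite vB mul0mx.
rewrite limg_dim_eq // dim_rowvf mxrank_ker subnK //.
exact: rank_leq_row.
Qed.

(** Independent rows are selected first, then independent columns among them. Minors replace ranks
    because determinants commute with ring morphisms. *)
Lemma unit_minor (F : fieldType) (m n : nat) (N : 'M[F]_(m, n)) :
  exists (f : 'I_(\rank N) -> 'I_m) (g : 'I_(\rank N) -> 'I_n),
    mxsub f g N \in unitmx.
Proof.
pose f := maxrankfun N; pose M := rowsub f N.
have rM : \rank M^T = \rank N by rewrite mxrank_tr eq_maxrowsub.
pose h := maxrankfun M^T; have := maxrowsub_free M^T; rewrite -/h => hfree.
exists f, (h \o cast_ord (esym rM)).
have -> : mxsub f (h \o cast_ord (esym rM)) N =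
          (rowsub (h \o cast_ord (esym rM)) M^T)^T.
  by apply/matrixP => i j; rewrite !mxE.
rewrite unitmx_tr -row_free_unit /row_free.
rewrite (_ : \rank _ = \rank (rowsub h M^T)); last first.
  have le_r : (\rank M^T <= \rank N)%N by rewrite rM.
  by rewrite (eqmx_rowsub_comp _ _ le_r (@cast_ord_inj _ _ (esym rM))).
by rewrite eq_maxrowsub rM.
Qed.

Lemma leq_rank_mxsub (F : fieldType) (m n r : nat) (N : 'M[F]_(m, n))
    (f : 'I_r -> 'I_m) (g : 'I_r -> 'I_n) :
  mxsub f g N \in unitmx -> (r <= \rank N)%N.
Proof.
move=> /mxrank_unit <-; rewrite -[N]mulmx1 mxsub_mul.
apply: leq_trans (mxrankM_maxl _ _) _.
by rewrite mulmx1; exact/mxrankS/rowsub_sub.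
Qed.

Section SpecializeRank.
Variables (R : comNzRingType) (K F : fieldType).
Variables (iota : {rmorphism R -> K}) (psi : {rmorphism R -> F}).
Hypothesis iota_inj : injective iota.

(** A minor that survives [psi] is non-zero in [R], hence survives the injective [iota]. *)
Lemma rank_specialize m n (N : 'M[R]_(m, n)) :
  (\rank (map_mx psi N) <= \rank (map_mx iota N))%N.
Proof.
have [f [g]] := unit_minor (map_mx psi N).
rewrite -map_mxsub unitmxE det_map_mx unitfE => dN.
apply: (@leq_rank_mxsub _ _ _ _ _ f g).
rewrite -map_mxsub unitmxE det_map_mx unitfE.
rewrite -(rmorph0 iota) (inj_eq iota_inj).
by apply: contraNneq dN => ->; rewrite rmorph0.
Qed.

(* Cramer's rule for a minor of N that stays non-zero under psi clears the     *)
(* denominators of a. *)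
Lemma cramer_specialize m r (N : 'M[R]_(m, r)) (c : 'cV[R]_m) (a : 'cV[K]_r) :
  \rank (map_mx psi N) = r -> map_mx iota c = map_mx iota N *m a ->
  exists (e : R) (b : 'cV[R]_r), e *: c = N *m b /\ psi e != 0.
Proof.
move=> rN ca; have [f [g]] := unit_minor (map_mx psi N).
move: f g; rewrite rN => f g.
rewrite -map_mxsub unitmxE det_map_mx unitfE => dN.
have {dN} dN : psi (\det (rowsub f N)) != 0.
  apply: contraNneq dN => d0.
  (* With r columns in all, [g] merely permutes them; factoring the minor through a column selection
     of the identity spares a proof of this. *)
  have gN : mxsub f g N = rowsub f N *m colsub g 1%:M.
    by rewrite -mxsub_mul mulmx1.
  by rewrite gN det_mulmx rmorphM /= d0 mul0r.
exists (\det (rowsub f N)), (\adj (rowsub f N) *m rowsub f c); split=> //.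
suff E : map_mx iota (\det (rowsub f N) *: c) =
         map_mx iota (N *m (\adj (rowsub f N) *m rowsub f c)).
  by apply/matrixP => i j; move/matrixP/(_ i j): E; rewrite !mxE => /iota_inj.
rewrite map_mxZ !map_mxM /= ca scalemxAr; congr (_ *m _).
have -> : map_mx iota (rowsub f c) = rowsub f (map_mx iota N) *m a.
  by rewrite map_mxsub ca mul_rowsub_mx.
rewrite -map_mxsub mulmxA -map_mxM mul_adj_mx map_scalar_mx.
by rewrite mul_scalar_mx.
Qed.

End SpecializeRank.

Lemma set_induction (T : finType) (P : {set T} -> Prop) :
  P finset.set0 -> (forall i (B : {set T}), i \notin B -> P B -> P (i |: B)) ->
  forall B, P B.
Proof.
move=> P0 PU B; have [n] := ubnP #|B|; elim: n B => // n IH B ltBn.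
have [->//|[i iB]] := set_0Vmem B; rewrite -(finset.setD1K iB).
apply: PU; first by rewrite !inE eqxx.
by apply: IH; move: ltBn; rewrite (cardsD1 i) iB.
Qed.

Section ZeroLoci.
Variables (F : fieldType) (d : nat) (I : finType) (l : I -> 'cV[F]_d).
Implicit Types (B C : {set I}) (i : I).

Definition common_zeros B : {vspace 'rV[F]_d} :=
  (\bigcap_(i in B) zero_locus (l i))%VS.

Lemma common_zerosP B v :
  reflect (forall i, i \in B -> v *m l i = 0) (v \in common_zeros B).
Proof.
apply: (iffP idP) => [vB i iB|vB].
  apply/eqP; rewrite -zero_locusP; move: v vB; apply/subvP.
  by rewrite /common_zeros (bigD1 i) ?capvSl.
rewrite -[v \in _]/(<[v]> <= _)%VS; apply/subv_bigcapP => i iB.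
by rewrite -memvE zero_locusP vB.
Qed.

Lemma common_zerosS B C : B \subset C -> (common_zeros C <= common_zeros B)%VS.
Proof.
move=> /fintype.subsetP BC; apply/subvP => v /common_zerosP vC.
by apply/common_zerosP => i /BC /vC.
Qed.

Lemma common_zeros_le B i : i \in B -> (common_zeros B <= zero_locus (l i))%VS.
Proof.
by move=> iB; apply/subvP => v /common_zerosP/(_ i iB); rewrite zero_locusP => /eqP.
Qed.

Lemma common_zeros0 : common_zeros finset.set0 = fullv.
Proof. by rewrite /common_zeros big_set0. Qed.

Lemma common_zerosU1 B i :
  common_zeros (i |: B) = (zero_locus (l i) :&: common_zeros B)%VS.
Proof.
apply/vspaceP => v; rewrite memv_cap; apply/common_zerosP/andP => [vB|].
  split; first by rewrite zero_locusP vB ?setU11.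
  by apply/common_zerosP => j jB; rewrite vB // setU1r.
move=> [vi /common_zerosP vB] j; rewrite !inE => /orP[/eqP ->|/vB //].
by apply/eqP; rewrite -zero_locusP.
Qed.

Lemma dim_zero_locus i : (d <= (\dim (zero_locus (l i))).+1)%N.
Proof.
have E : (\dim (zero_locus (l i)) + \rank (l i))%N = d := dim_lker_mulmxr (l i).
by have := rank_leq_col (l i); lia.
Qed.

Lemma dim_cap_zero_locus i (U : {vspace 'rV[F]_d}) :
  (\dim U <= (\dim (zero_locus (l i) :&: U)).+1)%N.
Proof.
have := dimv_sum_cap (zero_locus (l i)) U.
have : (\dim (zero_locus (l i) + U) <= d)%N.
  by rewrite (leq_trans (dimvS (subvf _))) // dim_rowvf.
have := dim_zero_locus i; lia.
Qed.

Lemma dim_common_zeros B : (d <= \dim (common_zeros B) + #|B|)%N.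
Proof.
elim/set_induction: B => [|i B iB IH].
  by rewrite common_zeros0 dim_rowvf leq_addr.
have := dim_cap_zero_locus i (common_zeros B).
by rewrite common_zerosU1 cardsU1 iB; lia.
Qed.

(** Greedy choice: a form joins [C] only if it lowers the dimension. Independence of [C] is
    expressed by its size being the codimension of its zeros. *)
Lemma basis_exists B : exists2 C : {set I}, C \subset B &
  common_zeros C = common_zeros B /\ (#|C| + \dim (common_zeros C))%N = d.
Proof.
suff [C CB [eC leC]] : exists2 C : {set I}, C \subset B &
    common_zeros C = common_zeros B /\ (#|C| + \dim (common_zeros C) <= d)%N.
  exists C => //; split=> //; apply/eqP.
  by rewrite eqn_leq leC addnC dim_common_zeros.
elim/set_induction: B => [|i B iB [C CB [eC leC]]].
  exists finset.set0; rewrite ?sub0set // common_zeros0; split=> //.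
  by rewrite cards0 dim_rowvf.
have [iC|iC] := boolP (common_zeros C <= zero_locus (l i))%VS.
  exists C; first by rewrite (fintype.subset_trans CB) // finset.subsetUr.
  by split=> //; rewrite common_zerosU1 -eC; apply/esym/capv_idPr.
exists (i |: C); first by rewrite finset.setUS.
rewrite !common_zerosU1 eC; split=> //.
have := cardsU1 i C; have := leC; rewrite eC in iC *.
have : (\dim (zero_locus (l i) :&: common_zeros B) < \dim (common_zeros B))%N.
  rewrite (ltn_leqif (dimv_leqif_sup (capvSr _ _))).
  by apply: contra iC => /subv_trans; apply; rewrite capvSl.
by lia.
Qed.

End ZeroLoci.

(** * Matroid of an arrangement with good reduction *)

(** The induced map sends the finite set of comparable pairs injectively into, hence onto,
    itself. *)
Lemma homo_inj_mono (disp : Order.disp_t) (T : finPOrderType disp) (h : T -> T) :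
  injective h -> {homo h : x y / (x <= y)%O} -> {mono h : x y / (x <= y)%O}.
Proof.
move=> h_inj h_homo x y; apply/idP/idP; last exact: h_homo.
pose P := [set u : T * T | (u.1 <= u.2)%O].
pose hh (u : T * T) := (h u.1, h u.2).
have hh_inj : injective hh by move=> [a b] [a' b'] [/h_inj -> /h_inj ->].
have /eqP PE : hh @: P == P.
  rewrite eqEcard card_imset // leqnn andbT.
  by apply/fintype.subsetP => _ /imsetP[u + ->]; rewrite !inE => /h_homo.
move=> hxy; have : (h x, h y) \in P by rewrite inE.
by rewrite -PE => /imsetP[[a b]]; rewrite inE /= => ab [/h_inj -> /h_inj ->].
Qed.

Section Reduction.
Variables (I : finType) (d : nat) (R : comNzRingType) (K F : fieldType).
Variables (iota : {rmorphism R -> K}) (psi : {rmorphism R -> F}).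
Hypothesis iota_inj : injective iota.
Variable l : I -> 'cV[R]_d.
Local Notation lK := (fun i => map_mx iota (l i)).
Local Notation lF := (fun i => map_mx psi (l i)).
Local Notation X := (common_zeros lK).
Local Notation Xbar := (common_zeros lF).
Implicit Types (B C : {set I}).

Definition forms_mx B : 'M[R]_(d, #|B|) :=
  \matrix_(j < d, c < #|B|) l (enum_val c) j 0.

Lemma common_zeros_lker (E : fieldType) (f : {rmorphism R -> E}) B :
  common_zeros (fun i => map_mx f (l i)) B =
  lker (linfun (mulmxr (map_mx f (forms_mx B)))).
Proof.
have colE (v : 'rV[E]_d) (c : 'I_#|B|) : (v *m map_mx f (forms_mx B)) 0 c =
    (v *m map_mx f (l (enum_val c))) 0 0.
  by rewrite !mxE; apply: eq_bigr => j _; rewrite !mxE.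
apply/vspaceP => v; rewrite memv_ker lfunE /=; apply/common_zerosP/eqP => [vB|vN].
  by apply/rowP => c; rewrite colE vB ?mxE // enum_valP.
move=> i iB; apply/matrixP => a b; rewrite !ord1 -(enum_rankK_in iB iB) -colE vN.
by rewrite !mxE.
Qed.

Lemma dim_common_zeros_rank (E : fieldType) (f : {rmorphism R -> E}) B :
  (\dim (common_zeros (fun i => map_mx f (l i)) B) +
    \rank (map_mx f (forms_mx B)))%N = d.
Proof. by rewrite common_zeros_lker dim_lker_mulmxr. Qed.

Lemma dim_common_zeros_specialize B : (\dim (X B) <= \dim (Xbar B))%N.
Proof.
have := rank_specialize psi iota_inj (forms_mx B).
have := dim_common_zeros_rank iota B; have := dim_common_zeros_rank psi B.
by lia.
Qed.

(** A basis over [F] stays independent over [K]: the zeros over [K] have dimension at least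
    [d - #|C|], and at most the dimension over [F], which is exactly this. *)
Lemma basis_specialize B : exists2 C : {set I}, C \subset B &
  [/\ Xbar C = Xbar B, (#|C| + \dim (Xbar C))%N = d & \dim (X C) = \dim (Xbar C)].
Proof.
have [C CB [eC dC]] := basis_exists lF B; exists C => //; split=> //.
apply/eqP; rewrite eqn_leq dim_common_zeros_specialize.
by have := dim_common_zeros lK C; lia.
Qed.

Definition flat_closure B := [set i | (X B <= zero_locus (lK i))%VS].

Lemma subset_closure B : B \subset flat_closure B.
Proof.
by apply/fintype.subsetP => i iB; rewrite inE; apply: (common_zeros_le lK).
Qed.

(** Adding a form of the closure keeps the dimension over [K], a lower bound for the one over [F].
    The latter starts at this bound, so it cannot drop. *)
Lemma closure_specialize C :
  \dim (X C) = \dim (Xbar C) -> Xbar (flat_closure C) = Xbar C.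
Proof.
move=> dC; apply/eqP; rewrite eqEsubv common_zerosS ?subset_closure //=.
apply/subv_bigcapP => i; rewrite inE => iC.
have : (\dim (X (i |: C)) <= \dim (Xbar (i |: C)))%N.
  exact: dim_common_zeros_specialize.
rewrite !common_zerosU1; move/capv_idPr: iC => ->; rewrite dC => le_dim.
apply/capv_idPr/eqP; rewrite eqEdim capvSr /=; exact: le_dim.
Qed.

Section GoodReduction.
Variables (disp disp' : Order.disp_t).
Variables (T : finPOrderType disp) (T' : finPOrderType disp').
Variables (flK : {set I} -> T) (flF : {set I} -> T').
Hypothesis flK_surj : forall x, exists B, flK B = x.
Hypothesis flF_surj : forall x, exists B, flF B = x.
Hypothesis flK_le : forall B C, (flK B <= flK C)%O = (X C <= X B)%VS.
Hypothesis flF_le : forall B C, (flF B <= flF C)%O = (Xbar C <= Xbar B)%VS.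
Variable f : T -> T'.
Hypothesis f_bij : bijective f.
Hypothesis f_mono : {mono f : x y / (x <= y)%O}.
Hypothesis l_simple : forall i j,
  (zero_locus (lK i) <= zero_locus (lK j))%VS -> i = j.

Let fl_eq B C : flK B = flK C -> X B = X C.
Proof.
by move=> BC; apply/eqP; rewrite eqEsubv -!flK_le BC lexx.
Qed.

Let flF_eq B C : flF B = flF C <-> Xbar B = Xbar C.
Proof.
split=> BC; first by apply/eqP; rewrite eqEsubv -!flF_le BC lexx.
by apply/eqP; rewrite eq_le !flF_le BC subvv.
Qed.

(* Good reduction only provides some abstract isomorphism f.  The natural map   *)
(* rho, sending a flat to the intersection of the reductions of the hyperplanes *)
(* containing it, is monotone and surjective; comparing the numbers of flats    *)
(* and of comparable pairs of flats with the help of f, it is an isomorphism.   *)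
Let rep x := sval (cid (flK_surj x)).
Let repK x : flK (rep x) = x. Proof. exact: svalP (cid (flK_surj x)). Qed.
Let rho x := flF (flat_closure (rep x)).
Let rho_fl B : rho (flK B) = flF (flat_closure B).
Proof.
congr flF; apply/setP => i; rewrite !inE; congr (_ <= _)%VS.
by apply: fl_eq; rewrite repK.
Qed.

Let rho_homo : {homo rho : x y / (x <= y)%O}.
Proof.
move=> x y; rewrite -(repK x) -(repK y) !rho_fl !flK_le flF_le => xy.
apply: common_zerosS; apply/fintype.subsetP => i; rewrite !inE.
exact: subv_trans.
Qed.

(** A preimage is the flat over [K] of a basis of [u] chosen over [F]; as the dimensions agree,
    closing it up adds no condition after reduction. *)
Let rho_surj u : exists B, [/\ rho (flK B) = u, flF B = u & \dim (X B) = \dim (Xbar B)].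
Proof.
have [B <-] := flF_surj u; have [C CB [eC _ dC]] := basis_specialize B.
exists C; split=> //; last exact/flF_eq.
by rewrite rho_fl; apply/flF_eq; rewrite closure_specialize.
Qed.

Let rho_inj : injective rho.
Proof.
have [g fK gK] := f_bij.
pose h := g \o rho; have hs y : exists x, h x = y.
  by have [B [rB _ _]] := rho_surj (f y); exists (flK B); rewrite /h /= rB fK.
(* A section of the surjective self-map [h] is injective, hence bijective on a finite type, and [h]
   is its inverse. *)
pose s y := sval (cid (hs y)).
have sK : cancel s h by move=> y; exact: svalP (cid (hs y)).
have [t st ts] := injF_bij (can_inj sK).
have ht : h =1 t by move=> x; rewrite -{1}(ts x) sK.
by move=> x y xy; apply: (can_inj ts); rewrite -!ht /h /= xy.
Qed.

Let rho_mono : {mono rho : x y / (x <= y)%O}.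
Proof.
have [g fK gK] := f_bij.
have gm : {mono g : x y / (x <= y)%O} by move=> x y; rewrite -f_mono !gK.
have h_inj : injective (g \o rho) := inj_comp (can_inj gK) rho_inj.
have h_homo : {homo (g \o rho) : x y / (x <= y)%O}.
  by move=> x y xy; rewrite /= gm rho_homo.
by move=> x y; have := homo_inj_mono h_inj h_homo x y; rewrite /= gm.
Qed.

(** Here the isomorphism of posets becomes an equality of matroids: a basis of [B] over [F] also
    spans [B] over [K], because [rho] reflects the order between an atom and the flat of [C]. *)
Lemma good_common_zeros_sub B : exists2 C : {set I}, C \subset B &
  [/\ Xbar C = Xbar B, X C = X B, (#|C| + \dim (Xbar C))%N = d
    & \dim (X C) = \dim (Xbar C)].
Proof.
have [C CB [eC cC dC]] := basis_specialize B; exists C => //; split=> //.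
apply/eqP; rewrite eqEsubv (common_zerosS _ CB) andbT.
apply/subv_bigcapP => i iB.
have : (flK [set i] <= flK C)%O.
  rewrite -rho_mono !rho_fl flF_le closure_specialize // eC.
  apply/subv_bigcapP => j; rewrite inE => ij.
  (* No other hyperplane contains that of [i], so the closure of the atom is [i] alone. *)
  have <- : i = j.
    by apply: l_simple; move: ij; rewrite /common_zeros big_set1.
  exact: (common_zeros_le lF).
by rewrite flK_le /common_zeros big_set1.
Qed.

Lemma good_dim_common_zeros B : \dim (Xbar B) = \dim (X B).
Proof. by have [C _ [<- <- _ ->]] := good_common_zeros_sub B. Qed.

Lemma good_closure B i : (X B <= zero_locus (lK i))%VS ->
  (Xbar B <= zero_locus (lF i))%VS.
Proof.
move=> iB; apply/capv_idPr/eqP; rewrite eqEdim capvSr /= -(common_zerosU1 lF).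
rewrite !good_dim_common_zeros common_zerosU1.
by have /capv_idPr -> : (X B <= zero_locus ((lK) i))%VS := iB.
Qed.

(** Over [K] the form depends on an independent [C] inside [B]. As [C] stays independent over [F],
    Cramer's rule has a denominator that survives [psi]. *)
Lemma good_span B i : (X B <= zero_locus (lK i))%VS ->
  exists (e : R) (b : I -> R),
    e *: l i = \sum_(j in B) b j *: l j /\ psi e != 0.
Proof.
have [C CB [_ eX cC dC]] := good_common_zeros_sub B; rewrite -eX => Ci.
have rN : \rank (map_mx psi (forms_mx C)) = #|C|.
  by have := dim_common_zeros_rank psi C; lia.
have [a ca] : exists a, map_mx iota (l i) = map_mx iota (forms_mx C) *m a.
  suff /submxP[a E] : ((map_mx iota (l i))^T <= (map_mx iota (forms_mx C))^T)%MS.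
    by exists a^T; rewrite -[LHS]trmxK E trmx_mul trmxK.
  (* The columns of the cokernel, transposed, are vectors killed by all forms in [C], hence by form
     [i]. *)
  set N := map_mx iota (forms_mx C); rewrite submxE -[_ *m _]trmxK trmx_mul trmxK.
  apply/eqP; rewrite -[RHS]trmx0; congr trmx; apply/row_matrixP => j.
  rewrite row_mul row0; apply/eqP; rewrite -zero_locusP; apply: (subvP Ci).
  rewrite common_zeros_lker memv_ker lfunE /= -row_mul -[_ *m N]trmxK.
  by rewrite trmx_mul trmxK mulmx_coker trmx0 row0.
have [e [b [E eN0]]] := cramer_specialize iota_inj rN ca.
exists e, (fun j => \sum_(c < #|C| | enum_val c == j) b c 0); split=> //.
rewrite E; apply/matrixP => p q; rewrite !ord1 {q} !mxE summxE.
rewrite (bigID (fun j => j \in C)) /= [X in _ = _ + X]big1 ?addr0; last first.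
  move=> j /andP[_ jC]; rewrite !mxE big1 ?mul0r // => c /eqP cj.
  by rewrite -cj enum_valP in jC.
transitivity (\sum_(j in C) \sum_(c < #|C| | enum_val c == j) b c 0 * l j p 0).
  rewrite (exchange_big_dep predT) //=; apply: eq_bigr => c _; rewrite mxE mulrC.
  rewrite (big_pred1 (enum_val c)) // => j.
  by apply/idP/eqP => [/andP[_ /eqP <-] //|->]; rewrite enum_valP eqxx.
apply: eq_big => [j|j _]; last by rewrite !mxE mulr_suml.
by case jC: (j \in C); rewrite ?andbF //= ?andbT (fintype.subsetP CB).
Qed.

(** Independent forms take arbitrary values simultaneously. This serves to choose a digit that makes
    the forms of a flat divisible by one more power of the uniformizer. *)
Lemma good_solve B : exists2 C : {set I}, C \subset B & X C = X B /\
  forall c : I -> F, exists w : 'rV[F]_d,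
    forall i, i \in C -> w *m map_mx psi (l i) = (c i)%:M.
Proof.
have [C CB [_ eX cC dC]] := good_common_zeros_sub B; exists C => //; split=> // c.
have rN : row_full (map_mx psi (forms_mx C)).
  by rewrite /row_full; have := dim_common_zeros_rank psi C; lia.
exists ((\row_j c (enum_val j)) *m pinvmx (map_mx psi (forms_mx C))) => i iC.
set P := pinvmx _; have -> : map_mx psi (l i) =
    col (enum_rank_in iC i) (map_mx psi (forms_mx C)).
  by apply/matrixP => p q; rewrite !mxE !ord1 enum_rankK_in.
rewrite colEsub mulmx_colsub -mulmxA mulVpmx // mulmx1; apply/matrixP => p q.
by rewrite !ord1 !mxE enum_rankK_in // mulr1n.
Qed.

End GoodReduction.
End Reduction.

(** * Flats and point counts of strata *)

Section Flats.
Variables (F : fieldType) (d : nat).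
Implicit Types (U x : {vspace 'rV[F]_d}) (A B : {fset {vspace 'rV[F]_d}}).

Lemma memv_bigcap_seq (s : seq {vspace 'rV[F]_d}) v :
  (v \in (\bigcap_(H <- s) H)%VS) = all (fun H : {vspace 'rV[F]_d} => v \in H) s.
Proof.
by elim: s => [|H s IH]; rewrite ?big_nil ?memvf // big_cons memv_cap IH.
Qed.

Lemma intersectionsP U A x :
  reflect (exists2 B, (B `<=` A)%fset &
            forall v, (v \in x) =
              (v \in U) && all (fun H : {vspace 'rV[F]_d} => v \in H) (enum_fset B))
          (x \in intersections U A).
Proof.
rewrite /intersections; apply: (iffP (imfsetP _ _ _ _)) => [[B /=]|[B BA xE]].
  by rewrite fpowersetE => BA ->; exists B => // v; rewrite memv_cap memv_bigcap_seq.
exists B; rewrite /= ?fpowersetE //.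
by apply/vspaceP => v; rewrite xE memv_cap memv_bigcap_seq.
Qed.

(** Flats are indexed by sets of forms and not of hyperplanes, since distinct reduced forms might a
    priori have the same zeros. *)
Lemma common_zeros_intersections (I : finType) (l : I -> 'cV[F]_d) A x :
  (forall H, reflect (exists i, H = zero_locus (l i)) (H \in A)) ->
  reflect (exists B : {set I}, common_zeros l B = x) (x \in intersections fullv A).
Proof.
move=> AP; apply: (iffP (intersectionsP _ _ _)) => [[B /fsubsetP BA xE]|[B <-]].
  exists [set i | zero_locus (l i) \in B]; apply/vspaceP => v; rewrite xE memvf /=.
  apply/common_zerosP/allP => [vB H HB|vB i].
    have /AP[i Hi] := BA H HB; rewrite Hi zero_locusP.
    by apply/eqP/vB; rewrite inE -Hi.
  by rewrite inE => /vB; rewrite zero_locusP => /eqP.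
exists [fset zero_locus (l i) | i in B]%fset.
  by apply/fsubsetP => _ /imfsetP[i _ ->]; apply/AP; exists i.
move=> v; rewrite memvf /=; apply/common_zerosP/allP => [vB _ /imfsetP[i iB ->]|vB i iB].
  by rewrite zero_locusP vB.
by apply/eqP; rewrite -zero_locusP; apply: vB; apply/imfsetP; exists i.
Qed.

Lemma flat_leE U A (x y : intposet U A) :
  (x <= y)%O = (flat_space y <= flat_space x)%VS.
Proof. by []. Qed.

Lemma flat0_le U A (x : intposet U A) : (flat0 U A <= x)%O.
Proof.
rewrite flat_leE; apply/subvP => v.
by have /intersectionsP[B _ ->] := valP x => /andP[].
Qed.

End Flats.

Lemma sum_mobius_bottom (disp : Order.disp_t) (T : finPOrderType disp) (b y : T) :
  (forall x, (b <= x)%O) -> \sum_(x | (x <= y)%O) mobius b x = (y == b)%:R.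
Proof.
move=> b_min; rewrite (bigD1 y) //= mobiusE eq_sym.
have -> : \sum_(x | (x <= y)%O && (x != y)) mobius b x =
          \sum_(x | (b <= x < y)%O) mobius b x.
  by apply: eq_bigl => x; rewrite b_min lt_neqAle andbC.
case: eqVneq => [->|_]; last by rewrite addNr.
rewrite big_pred0 ?addr0 // => x; rewrite b_min /=.
by apply/negP => /(le_lt_trans (b_min x)); rewrite ltxx.
Qed.

Section ReducedArrangement.
Variables (K : fieldType) (d : nat) (A : {fset {vspace 'rV[K]_d}}).
Hypothesis A_arr : arrangement_in fullv A.
Variables (R : comNzRingType) (iota : {rmorphism R -> K}).
Hypothesis iota_inj : injective iota.
Variable L : A -> 'cV[R]_d.
Hypothesis L_locus : forall H : A, zero_locus (map_mx iota (L H)) = fsval H.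
Variables (Fq : finFieldType) (psi : {rmorphism R -> Fq}).
Hypothesis A_good : good_reduction L psi.
Local Notation LK := (fun H : A => map_mx iota (L H)).
Local Notation LF := (fun H : A => map_mx psi (L H)).
Local Notation X := (common_zeros LK).
Local Notation Xbar := (common_zeros LF).
Local Notation LA := (intposet fullv A).
Implicit Types (B : {set A}) (H : A) (x y z : LA).

Lemma arrangementP (G : {vspace 'rV[K]_d}) :
  reflect (exists H : A, G = zero_locus (LK H)) (G \in A).
Proof.
apply: (iffP idP) => [GA|[H ->]]; last by rewrite L_locus; apply: valP.
by exists (FSetSub GA); rewrite L_locus.
Qed.

Lemma common_zeros_subproof B : X B \in intersections fullv A.
Proof. by apply/(common_zeros_intersections _ arrangementP); exists B. Qed.

Definition flat_of B : LA := FSetSub (common_zeros_subproof B).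

Lemma arrangement_simple H H' :
  (zero_locus (LK H) <= zero_locus (LK H'))%VS -> H = H'.
Proof.
rewrite !L_locus => HH'; apply/val_inj/eqP; rewrite eqEdim HH' /=.
have [_ dH] := A_arr (valP H); have [_ dH'] := A_arr (valP H').
by rewrite -ltnS dH dH'.
Qed.

Lemma good_arrangement B :
  [/\ \dim (Xbar B) = \dim (X B),
      forall H, (X B <= fsval H)%VS -> (Xbar B <= zero_locus (LF H))%VS,
      forall H, (X B <= fsval H)%VS -> exists (e : R) (b : A -> R),
        e *: L H = \sum_(H' in B) b H' *: L H' /\ psi e != 0
    & exists2 C : {set A}, C \subset B & X C = X B /\
        forall c : A -> Fq, exists w : 'rV[Fq]_d,
          forall H, H \in C -> w *m LF H = (c H)%:M].
Proof.
have [f f_bij f_mono] := A_good.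
set A' := [fset zero_locus (LF H) | H : A]%fset in f f_bij f_mono.
have A'P (G : {vspace 'rV[Fq]_d}) :
    reflect (exists H : A, G = zero_locus (LF H)) (G \in A').
  apply: (iffP (imfsetP _ _ _ _)) => [[H _ ->]|[H ->]]; first by exists H.
  by exists H.
have sub' C : Xbar C \in intersections fullv A'.
  by apply/(common_zeros_intersections _ A'P); exists C.
pose flF C : intposet fullv A' := FSetSub (sub' C).
have surjK x : exists C, flat_of C = x.
  have /(common_zeros_intersections _ arrangementP)[C CE] := valP x.
  by exists C; apply: val_inj.
have surjF (x : intposet fullv A') : exists C, flF C = x.
  have /(common_zeros_intersections _ A'P)[C CE] := valP x.
  by exists C; apply: val_inj.
have leK C D : (flat_of C <= flat_of D)%O = (X D <= X C)%VS by [].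
have leF C D : (flF C <= flF D)%O = (Xbar D <= Xbar C)%VS by [].
have simple := arrangement_simple.
split.
- exact: (good_dim_common_zeros iota_inj surjK surjF leK leF f_bij f_mono simple).
- move=> H; rewrite -L_locus.
  exact: (good_closure iota_inj surjK surjF leK leF f_bij f_mono simple).
- move=> H; rewrite -L_locus.
  exact: (good_span iota_inj surjK surjF leK leF f_bij f_mono simple).
- exact: (good_solve iota_inj surjK surjF leK leF f_bij f_mono simple).
Qed.

Definition containing (U : {vspace 'rV[K]_d}) : {set A} :=
  [set H : A | (U <= fsval H)%VS].

Lemma common_zeros_containing_ge U : (U <= X (containing U))%VS.
Proof.
by apply/subv_bigcapP => H; rewrite inE L_locus.
Qed.

Lemma common_zeros_containing x : X (containing (flat_space x)) = flat_space x.
Proof.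
apply/eqP; rewrite eqEsubv common_zeros_containing_ge andbT.
have [B <-] : exists B, X B = flat_space x.
  by apply/(common_zeros_intersections _ arrangementP); apply: (valP x).
apply: common_zerosS; apply/fintype.subsetP => H HB; rewrite inE -L_locus.
exact: (common_zeros_le LK).
Qed.

Lemma containingS (U V : {vspace 'rV[K]_d}) :
  (U <= V)%VS -> containing V \subset containing U.
Proof.
by move=> UV; apply/fintype.subsetP => H; rewrite !inE; apply: subv_trans.
Qed.

Section Count.
Variables (y z : LA).
Hypothesis zy : (z <= y)%O.
Local Notation Uz := (flat_space z).
Local Notation Ay := (containing (flat_space y)).
Local Notation B0 := (restriction (localization A (flat_space y)) Uz).
Local Notation P := (intposet Uz B0).

Let restrP (G : {vspace 'rV[K]_d}) : reflect
  (exists H : A, [/\ H \in Ay, H \notin containing Uz & G = (fsval H :&: Uz)%VS])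
  (G \in B0).
Proof.
apply: (iffP (imfsetP _ _ _ _)) => [[H /=]|[H [Hy Hz ->]]].
  rewrite !inE /= => /andP[+ /andP[HA Hy]].
  rewrite HA Hy /= => Hz ->.
  by exists (FSetSub HA); rewrite !inE.
exists (fsval H) => //; rewrite !inE in Hy Hz.
by rewrite /= !inE /= Hy (valP H) /= andbT.
Qed.

Definition vanishing (w : 'rV[Fq]_d) : {set A} :=
  [set H : A | w *m LF H == 0].

(** The restriction omits the hyperplanes containing [Uz], but these impose no condition inside
    [Uz]. *)
Let xw_subproof w : (Uz :&: X (Ay :&: vanishing w))%VS \in intersections Uz B0.
Proof.
apply/intersectionsP.
exists [fset (fsval H :&: Uz)%VS | H in (Ay :&: vanishing w) :\: containing Uz]%fset.
  apply/fsubsetP => _ /imfsetP[H /= + ->]; rewrite inE => /andP[Hz].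
  by rewrite inE => /andP[Hy _]; apply/restrP; exists H.
move=> v; rewrite memv_cap; case vz: (v \in Uz) => //=.
apply/common_zerosP/allP => [vD _ /imfsetP[H /= + ->]|vD H HD].
  by rewrite inE => /andP[_ /vD vH]; rewrite memv_cap vz -L_locus zero_locusP vH eqxx.
apply/eqP; rewrite -zero_locusP L_locus.
have [Hz|Hz] := boolP (H \in containing Uz).
  by move: Hz; rewrite inE => /subvP; apply.
have /vD : (fsval H :&: Uz)%VS \in
    [fset (fsval H :&: Uz)%VS | H in (Ay :&: vanishing w) :\: containing Uz]%fset.
  by apply/imfsetP; exists H; rewrite //= inE Hz HD.
by rewrite memv_cap => /andP[].
Qed.

Let xw w : P := FSetSub (xw_subproof w).

Let N (U : {vspace 'rV[K]_d}) := Xbar (containing U).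

Let P_le (x : P) : (flat_space x <= Uz)%VS := flat0_le x.

Let P_eq (x : P) :
  (Uz :&: X (Ay :&: containing (flat_space x)) <= flat_space x)%VS.
Proof.
have /intersectionsP[B BR xE] := valP x.
apply/subvP => v; rewrite memv_cap => /andP[vz /common_zerosP vD].
rewrite [_ \in _]xE vz /=; apply/allP => G GB.
have /restrP[H [Hy _ GE]] := fsubsetP BR _ GB.
rewrite GE memv_cap vz andbT -L_locus zero_locusP; apply/eqP/vD.
rewrite !inE in Hy *; rewrite Hy /=; apply/subvP => u.
by rewrite [_ \in _]xE => /andP[_ /allP/(_ G GB)]; rewrite GE memv_cap => /andP[].
Qed.

Let P_common (x : P) : X (containing (flat_space x)) = flat_space x.
Proof.
apply/eqP; rewrite eqEsubv common_zeros_containing_ge andbT.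
apply: subv_trans (P_eq x); rewrite subv_cap (common_zerosS _ (finset.subsetIr _ _)) andbT.
by have := common_zerosS LK (containingS (P_le x)); rewrite common_zeros_containing.
Qed.

Let xw_small w : w \in N Uz -> flat_space (xw w) = X (Ay :&: vanishing w).
Proof.
move=> /common_zerosP wz; apply/capv_idPr.
rewrite -(common_zeros_containing z) common_zerosS //.
apply/fintype.subsetP => H Hz; rewrite !inE wz // eqxx andbT.
by rewrite inE in Hz; apply: subv_trans Hz; rewrite -flat_leE.
Qed.

Let in_N w B : B \subset vanishing w -> w \in Xbar B.
Proof.
move=> /fintype.subsetP Bw; apply/common_zerosP => H /Bw; rewrite inE => /eqP.
exact.
Qed.

(** This is the shape needed for Moebius inversion. Good reduction enters in the converse: a
    hyperplane containing the common zeros over [K] of forms that vanish at [w] has itself a form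
    vanishing at [w]. *)
Let N_le (x : P) w : (w \in N (flat_space x)) = (w \in N Uz) && (x <= xw w)%O.
Proof.
apply/idP/andP => [wx|[wz xwx]].
  split; first by apply: subvP wx; apply: common_zerosS; apply: containingS.
  rewrite flat_leE; apply: subv_trans (P_eq x); apply: capvS => //.
  apply: common_zerosS; apply: finset.setIS; apply/fintype.subsetP => H Hx.
  by rewrite inE; apply/eqP; move/common_zerosP: wx; apply.
apply/common_zerosP => H; rewrite inE => xH; apply/eqP; rewrite -zero_locusP.
have [_ cl _ _] := good_arrangement (Ay :&: vanishing w).
have /cl/subvP : (X (Ay :&: vanishing w) <= fsval H)%VS.
  by rewrite -(xw_small wz); apply: subv_trans xH; rewrite -flat_leE.
by apply; apply: in_N; apply: finset.subsetIr.
Qed.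

Let card_N (x : P) : #|[set w | w \in N (flat_space x)]| = (#|Fq| ^ \dim (flat_space x))%N.
Proof.
rewrite cardsE card_vspace; have [dE _ _ _] := good_arrangement (containing (flat_space x)).
by rewrite /N dE P_common.
Qed.

Lemma card_stratum :
  #|[set w : 'rV[Fq]_d | X (Ay :&: vanishing w) == Uz]|%:R =
  #|Fq|%:R ^+ \dim Uz *
    (map_poly intr (poincare Uz B0)).[- (#|Fq|%:R)^-1] :> rat.
Proof.
have q0 : #|Fq|%:R != 0 :> rat by rewrite pnatr_eq0 -lt0n; apply/card_gt0P; exists 0.
have -> : [set w : 'rV[Fq]_d | X (Ay :&: vanishing w) == Uz] =
          [set w | (w \in N Uz) && (xw w == flat0 Uz B0)].
  apply/setP => w; rewrite !inE; apply/eqP/andP => [wE|[wz /eqP wE]].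
    have wz : w \in N Uz.
      apply/common_zerosP => H; rewrite inE => zH; apply/eqP; rewrite -zero_locusP.
      have [_ cl _ _] := good_arrangement (Ay :&: vanishing w).
      have /cl/subvP : (X (Ay :&: vanishing w) <= fsval H)%VS by rewrite wE.
      by apply; apply: in_N; apply: finset.subsetIr.
    by split=> //; apply/eqP/val_inj; rewrite -[LHS]/(flat_space (xw w)) xw_small.
  by rewrite -xw_small // wE.
rewrite /poincare rmorph_sum /= horner_sum mulr_sumr.
(* The indicator of [xw w] being the bottom is the sum of the Moebius values below [xw w];
   exchanging sums leaves the points of the reduction of each [x]. *)
transitivity (\sum_(x : P) (mobius (flat0 Uz B0) x)%:~R *
    (\sum_(w in N Uz) (x <= xw w)%O%:R) : rat).
  under [RHS]eq_bigr do rewrite mulr_sumr.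
  rewrite exchange_big /= -sum1_card natr_sum.
  rewrite big_mkcond [RHS]big_mkcond; apply: eq_bigr => w _ /=.
  rewrite inE; case: (w \in N Uz) => //=.
  under [RHS]eq_bigr do rewrite mulr_natr mulrb.
  rewrite -big_mkcond /= -rmorph_sum /= sum_mobius_bottom; last exact: flat0_le.
  by case: eqP.
apply: eq_bigr => x _; rewrite rmorphM /= map_polyC /= hornerM hornerC.
rewrite mulrCA; congr (_ * _).
(* At -1/q the two signs cancel, and the factor q to the minus rank turns q^(dim z) into q^(dim
   x). *)
rewrite rmorphXn rmorphN /= map_polyX horner_exp hornerN hornerX opprK.
have le_dim : (\dim (flat_space x) <= \dim Uz)%N by apply/dimvS/P_le.
rewrite /rk exprVn -expfB_cond; last by rewrite (negPf q0) leq_subr.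
rewrite subKn //.
rewrite -natrX -card_N -sum1_card natr_sum big_mkcond [RHS]big_mkcond /=.
by apply: eq_bigr => w _; rewrite inE N_le; case: (w \in _); case: (_ <= _)%O.
Qed.

End Count.
End ReducedArrangement.

(** * Discrete valuation rings and digit expansions *)

Section Uniformizer.
Variable o : idomainType.
Hypothesis o_dvr : is_dvr o.

Lemma max_ideal_ideal : is_ideal (@max_ideal o).
Proof.
have [_ maxD _] := o_dvr; split=> //; first by rewrite /max_ideal /= unitr0.
by move=> a x; rewrite /max_ideal /= unitrM negb_and orbC => ->.
Qed.

Lemma uniformizer_exists : exists2 p : o, p != 0 &
  forall x, max_ideal x <-> exists a, x = a * p.
Proof.
have [princ _ [x0 x0max x0N0]] := o_dvr.
have [p pE] := princ _ max_ideal_ideal; exists p.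
  by move: x0max; rewrite pE => -[a _ ax0]; apply: contraNneq x0N0 => p0;
     rewrite -ax0 p0 mulr0.
by move=> x; rewrite pE; split=> [[a _ <-]|[a ->]]; exists a.
Qed.

End Uniformizer.

Section MaxPow.
Variables (o : idomainType) (p : o).
Hypothesis p_max : forall x, max_ideal x <-> exists a, x = a * p.

Lemma max_powP k x : max_pow k x <-> exists a, x = a * p ^+ k.
Proof.
elim: k x => [|k IH] x; first by split=> // _; exists x; rewrite mulr1.
split=> [xI|[a ->]].
  (* [max_pow] is an intersection of ideals; it is tested against the ideal generated by
     [p ^+ k.+1]. *)
  apply: (xI [set x | exists a, x = a * p ^+ k.+1]%classic); split.
    split=> [|_ _ [a ->] [b ->]|a _ [b ->]].
    - by exists 0; rewrite mul0r.
    - by exists (a + b); rewrite mulrDl.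
    - by exists (a * b); rewrite mulrA.
  move=> _ [a [b [/p_max[a' ->] /IH[b' ->] ->]]].
  by exists (a' * b'); rewrite mulrACA -exprS.
move=> N [[_ _ NM] sN]; apply: NM; apply: sN; exists p, (p ^+ k).
rewrite exprS; split=> //; first by apply/p_max; exists 1; rewrite mul1r.
by apply/IH; exists 1; rewrite mul1r.
Qed.

Lemma residue_map_eq k x y :
  residue_map k x = residue_map k y <-> exists a, x - y = a * p ^+ k.
Proof.
rewrite -max_powP; split=> [/eqP|xy]; first by rewrite residue_mapE => /asboolP.
by apply/eqP; rewrite residue_mapE; apply/asboolP.
Qed.

Lemma residue_map_eq0 k x : residue_map k x = 0 <-> exists a, x = a * p ^+ k.
Proof. by rewrite -(rmorph0 (@residue_map o k)) residue_map_eq subr0. Qed.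

End MaxPow.

Section Representatives.
Variables (o : idomainType) (p : o) (V : lmodType o) (W : finType) (sg : W -> V).
Hypothesis sg_cover : forall v, exists w u, v = sg w + p *: u.
Hypothesis sg_sep : forall w w' u, sg w - sg w' = p *: u -> w = w'.
Hypothesis p_reg : forall v, p *: v = 0 -> v = 0 :> V.

(** Truncated expansions in powers of [p] with digits lifted by [sg]. A general module covers both
    [o] and its row vectors. *)
Fixpoint digit_reps k : seq V :=
  if k is k'.+1 then [seq v + p ^+ k' *: sg w | v <- digit_reps k', w <- enum W]
  else [:: 0].

Lemma digit_reps_cover k v :
  exists2 r, r \in digit_reps k & exists u, v - r = p ^+ k *: u.
Proof.
elim: k v => [|k IH] v.
  by exists 0; rewrite ?inE //; exists v; rewrite subr0 scale1r.
have [r rk [u vE]] := IH v; have [w [u' uE]] := sg_cover u.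
exists (r + p ^+ k *: sg w).
  by apply/allpairsP; exists (r, w); rewrite mem_enum.
by exists u'; rewrite opprD addrA vE uE scalerDr addrAC subrr add0r scalerA exprSr.
Qed.

Lemma powp_reg k v : p ^+ k *: v = 0 -> v = 0 :> V.
Proof.
elim: k v => [|k IH] v; first by rewrite scale1r.
by rewrite exprS -scalerA => /p_reg/IH.
Qed.

Lemma digit_reps_sep k r r' u : r \in digit_reps k -> r' \in digit_reps k ->
  r - r' = p ^+ k *: u -> r = r'.
Proof.
elim: k r r' u => [|k IH] r r' u; first by rewrite !inE => /eqP -> /eqP ->.
move=> /allpairsP[[v w] /= [vk _ ->]] /allpairsP[[v' w'] /= [v'k _ ->]].
rewrite opprD addrACA -scalerBr => E.
have vv' : v = v'.
  apply: (IH v v' (p *: u - (sg w - sg w'))) => //.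
  by rewrite scalerBr scalerA -exprSr -E addrK.
move: E; rewrite vv' subrr add0r exprSr -scalerA => /eqP.
by rewrite -subr_eq0 -scalerBr => /eqP/powp_reg/eqP; rewrite subr_eq0 => /eqP/sg_sep ->.
Qed.

Lemma digit_reps_uniq k : uniq (digit_reps k).
Proof.
elim: k => // k IH; apply: allpairs_uniq => //; first exact: enum_uniq.
move=> [v w] [v' w'] /allpairsP[[a b] /= [ak _ [-> ->]]].
move=> /allpairsP[[a' b'] /= [ak' _ [-> ->]]] /= E.
have E' : a - a' = p ^+ k *: (sg b' - sg b).
  by rewrite scalerBr -[in LHS](addrK (p ^+ k *: sg b) a) E addrAC [a' + _]addrC addrK.
have aa' := digit_reps_sep ak ak' E'; rewrite aa'; congr (_, _).
move/esym: E'; rewrite aa' subrr => /powp_reg E'.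
by symmetry; apply: (@sg_sep b' b 0); rewrite scaler0.
Qed.

Lemma size_digit_reps k : size (digit_reps k) = (#|W| ^ k)%N.
Proof.
by elim: k => //= k IH; rewrite size_allpairs IH -cardE expnSr.
Qed.

Lemma sum_digit_reps (E : nmodType) (G : V -> E) k :
  \sum_(v <- digit_reps k.+1) G v =
  \sum_(v <- digit_reps k) \sum_w G (v + p ^+ k *: sg w).
Proof.
by rewrite /= big_allpairs_dep; apply: eq_bigr => v _; rewrite big_enum.
Qed.

End Representatives.

Section ResidueField.
Variables (o : idomainType) (p : o).
Hypothesis p_neq0 : p != 0.
Hypothesis p_max : forall x, max_ideal x <-> exists a, x = a * p.
Variables (Fq : finFieldType) (red : {rmorphism o -> Fq}).
Hypothesis red_residue : is_residue_field red.

Definition lift_red (a : Fq) : o := sval (cid (red_residue.1 a)).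

Lemma lift_redK : cancel lift_red red.
Proof. by move=> a; apply: svalP (cid (red_residue.1 a)). Qed.

Lemma red_eq0 x : red x = 0 <-> exists a, x = a * p.
Proof. by rewrite -p_max; apply: red_residue.2. Qed.

Lemma red_unit x : red x != 0 -> x \is a GRing.unit.
Proof.
move=> xN0; apply/negPn/negP => xU; move/eqP: xN0; apply.
exact/(red_residue.2 x).
Qed.

Definition lift_row d (w : 'rV[Fq]_d) : 'rV[o]_d := map_mx lift_red w.

Lemma map_lift_row d : cancel (@lift_row d) (map_mx red).
Proof. by move=> w; apply/rowP => j; rewrite !mxE lift_redK. Qed.

Definition vec_reps d k := digit_reps p (@lift_row d) k.
Definition scal_reps k : seq o := @digit_reps o p o^o Fq lift_red k.

Lemma size_scal_reps k : size (scal_reps k) = (#|Fq| ^ k)%N.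
Proof. exact: size_digit_reps. Qed.

Lemma lift_red_cover (x : o^o) : exists w u, x = (lift_red w : o^o) + p *: u.
Proof.
have /red_eq0[u uE] : red (x - lift_red (red x)) = 0.
  by rewrite rmorphB lift_redK subrr.
exists (red x), u.
by rewrite -[X in _ = _ + X]/(p * u) mulrC -uE addrC subrK.
Qed.

Lemma lift_red_sep w w' (u : o^o) :
  (lift_red w : o^o) - lift_red w' = p *: u -> w = w'.
Proof.
move=> E; apply/eqP; rewrite -subr_eq0 -(lift_redK w) -(lift_redK w') -rmorphB.
by apply/eqP/red_eq0; exists u; rewrite mulrC.
Qed.

Lemma p_reg_scal (x : o^o) : p *: x = 0 -> x = 0.
Proof. by move/eqP; rewrite mulf_eq0 (negPf p_neq0) => /eqP. Qed.

Lemma lift_row_cover d (v : 'rV[o]_d) : exists w u, v = lift_row w + p *: u.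
Proof.
have H j : exists u, v 0 j = lift_red (red (v 0 j)) + p * u.
  have /red_eq0[u uE] : red (v 0 j - lift_red (red (v 0 j))) = 0.
    by rewrite rmorphB lift_redK subrr.
  by exists u; rewrite mulrC -uE addrC subrK.
exists (map_mx red v), (\row_j sval (cid (H j))).
by apply/rowP => j; rewrite !mxE; apply: svalP (cid (H j)).
Qed.

Lemma lift_row_sep d (w w' : 'rV[Fq]_d) u :
  lift_row w - lift_row w' = p *: u -> w = w'.
Proof.
move=> E; apply/rowP => j; apply: (@lift_red_sep _ _ (u 0 j)).
by move/rowP/(_ j): E; rewrite !mxE.
Qed.

Lemma p_reg_row d (v : 'rV[o]_d) : p *: v = 0 -> v = 0.
Proof.
by move=> v0; apply/rowP => j; move/rowP/(_ j): v0; rewrite !mxE => /p_reg_scal.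
Qed.

Lemma scal_reps_uniq k : uniq (map (@residue_map o k) (scal_reps k)).
Proof.
rewrite map_inj_in_uniq; last first.
  move=> x y xk yk /(residue_map_eq p_max)[a E].
  apply: (digit_reps_sep lift_red_sep p_reg_scal xk yk (u := a)).
  by rewrite E mulrC.
exact: (digit_reps_uniq lift_red_sep p_reg_scal).
Qed.

Lemma mem_scal_reps k (t : residue_ring o k) :
  t \in map (@residue_map o k) (scal_reps k).
Proof.
have [r rk [u E]] := digit_reps_cover lift_red_cover k (repr t : o^o).
apply/mapP; exists r => //; rewrite -[LHS]residue_mapK.
by apply/(residue_map_eq p_max); exists u; rewrite E mulrC.
Qed.

Lemma vec_reps_uniq d k :
  uniq (map (map_mx (@residue_map o k)) (@vec_reps d k)).
Proof.
rewrite map_inj_in_uniq; last first.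
  move=> x y xk yk E.
  have H j : exists u, x 0 j - y 0 j = u * p ^+ k.
    by apply/(residue_map_eq p_max); move/rowP/(_ j): E; rewrite !mxE.
  apply: (digit_reps_sep (@lift_row_sep d) (@p_reg_row d) xk yk
    (u := \row_j sval (cid (H j)))).
  by apply/rowP => j; rewrite !mxE [RHS]mulrC; apply: svalP (cid (H j)).
exact: (digit_reps_uniq (@lift_row_sep d) (@p_reg_row d)).
Qed.

Lemma mem_vec_reps d k (t : 'rV[residue_ring o k]_d) :
  t \in map (map_mx (@residue_map o k)) (@vec_reps d k).
Proof.
have [r rk [u E]] := digit_reps_cover (@lift_row_cover d) k (map_mx repr t).
apply/mapP; exists r => //; apply/rowP => j.
rewrite !mxE -[LHS]residue_mapK.
apply/(residue_map_eq p_max); exists (u 0 j); rewrite mulrC.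
by move/rowP/(_ j): E; rewrite !mxE.
Qed.

(* Multiplication by p^m identifies o/p^(k-m) with the ideal (p^m) of o/p^k. *)
Lemma multiples_reps k m (t : residue_ring o k) : (m <= k)%N ->
  reflect (exists b, t = residue_map k (p ^+ m) * b)
    (t \in [seq residue_map k (p ^+ m * x) | x <- scal_reps (k - m)]).
Proof.
move=> mk; apply: (iffP mapP) => [[x _ ->]|[b ->]].
  by exists (residue_map k x); rewrite rmorphM.
rewrite -[b]residue_mapK -rmorphM.
have [r rk [u E]] := digit_reps_cover lift_red_cover (k - m) (repr b : o^o).
exists r => //; apply/(residue_map_eq p_max); exists u.
rewrite -mulrBr [X in _ * X]E mulrA -exprD subnKC //; exact: mulrC.
Qed.

Lemma multiples_reps_uniq k m : (m <= k)%N ->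
  uniq [seq residue_map k (p ^+ m * x) | x <- scal_reps (k - m)].
Proof.
move=> mk; rewrite map_inj_in_uniq; last first.
  move=> x y xk yk /(residue_map_eq p_max)[a].
  have := exprD p m (k - m); rewrite subnKC // => ->.
  rewrite -mulrBr mulrCA => E.
  apply: (digit_reps_sep lift_red_sep p_reg_scal xk yk (u := a)).
  apply: (mulfI (expf_neq0 m p_neq0)); rewrite E.
  by congr (_ * _); exact: mulrC.
exact: (digit_reps_uniq lift_red_sep p_reg_scal).
Qed.

End ResidueField.

(** * Average kernel sizes over finite rings *)

Section FinOfSeq.
Variables (S : choiceType) (r : seq S).
Hypothesis r_uniq : uniq r.
Hypothesis r_all : forall t, t \in r.

Lemma seq_index_pcancel :
  pcancel (fun x => index x r) (fun n => nth None (map Some r) n).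
Proof. by move=> x; rewrite (nth_map x) ?index_mem // nth_index. Qed.

Lemma seq_finite_axiom : Finite.axiom r.
Proof. by move=> x; rewrite count_uniq_mem ?r_all. Qed.

(** The carrier remains [S], so sums over [S] and over this finite type are interchangeable by
    conversion. *)
Definition fin_of_seq : finType :=
  HB.pack S (Choice_isCountable.Build S seq_index_pcancel)
    (fintype.isFinite.Build S seq_finite_axiom).

End FinOfSeq.

Lemma card_set_fin (T : finType) (E : {pred T}) :
  card_set [set x | x \in E]%classic = #|E|.
Proof.
rewrite /card_set cardE; apply/perm_size/uniq_perm.
- exact: fset_uniq.
- exact: enum_uniq.
- move=> x; rewrite mem_enum in_fset_set; last exact: finite_finset.
  by apply/idP/idP; rewrite ?inE // => /set_mem.
Qed.

Lemma fsum_fin (T : finType) (E : nmodType) (G : T -> E) :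
  \sum_(z \in [set: T]) G z = \sum_z G z.
Proof.
rewrite fsbig_finite; last exact: finite_finset.
rewrite -big_enum; apply/perm_big/uniq_perm; rewrite ?fset_uniq ?enum_uniq // => x.
by rewrite mem_enum in_fset_set ?in_setT //; exact: finite_finset.
Qed.

(** The rule that kernel times image has the size of the source, phrased with translations [tr] so
    that the finite types need no algebraic structure. *)
Lemma card_fibers (T V : finType) (f : T -> V) (x0 : T) (tr : T -> T -> T) :
  (forall y, injective (tr y)) ->
  (forall x y, (f (tr y x) == f y) = (f x == f x0)) ->
  #|T| = (#|[set x | f x == f x0]| * #|f @: T|)%N.
Proof.
move=> tr_inj trE; rewrite mulnC -sum_nat_const -[LHS]sum1_card (partition_big_imset f) /=.
apply: eq_bigr => _ /imsetP[y _ ->].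
rewrite sum1dep_card -[RHS](card_imset _ (tr_inj y)).
apply: eq_card => u; rewrite inE; apply/eqP/imsetP => [fu|[x]]; last first.
  by rewrite inE => fx ->; apply/eqP; rewrite trE.
have [t _ tK] := injF_bij (tr_inj y).
by exists (t u); rewrite ?tK // inE -(trE _ y) tK fu.
Qed.

Section FiniteAsk.
Local Open Scope classical_set_scope.
Variables (R S : comPzRingType) (phi : R -> S) (I : finType) (m n : nat).
Variable M : 'M[{ffun I -> R^o}]_(m, n).
Local Notation spec z := (specialize (base_change phi M) z).
Variables (r : seq S) (r_uniq : uniq r) (r_all : forall t, t \in r).
Variables (vr : seq 'rV[S]_m) (vr_uniq : uniq vr) (vr_all : forall v, v \in vr).
Variable s : 'rV[S]_m -> 'I_n -> seq S.
Hypothesis s_uniq : forall v c, uniq (s v c).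
Hypothesis image_spec : forall v (u : 'rV[S]_n),
  (exists z, v *m spec z = u) <-> forall c, u 0 c \in s v c.

Lemma specializeD (z z' : {ffun I -> S}) : spec (z + z') = spec z + spec z'.
Proof.
apply/matrixP => i j; rewrite !mxE -big_split; apply: eq_bigr => k _.
by rewrite !ffunE mulrDr.
Qed.

Lemma ask_images :
  ask phi M = \sum_(v <- vr) ((\prod_(c < n) size (s v c))%N%:R)^-1.
Proof.
pose T := fin_of_seq r_uniq r_all.
have cardT : card_set [set: S] = #|T|.
  transitivity (card_set [set: T]); first by [].
  by rewrite -card_set_fin; congr card_set; apply/seteqP; split.
have T0 : (0 < #|T|)%N by apply/card_gt0P; exists (0 : S).
rewrite /ask cardT.
(* A pure conversion from [S] to [T], giving access to finite sums. *)
rewrite -[X in _ * X]/(\sum_(z \in [set: {ffun I -> T}])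
  (card_set [set v : 'rV[T]_m | v *m spec z = 0])%:R : rat).
rewrite fsum_fin.
under eq_bigr => z _.
  rewrite (_ : [set v : 'rV[T]_m | _] =
    [set x | x \in [pred v : 'rV[T]_m | (v : 'rV[S]_m) *m spec z == 0]]); last first.
    by apply/seteqP; split=> x /= => [/eqP //|]; rewrite inE => /eqP.
  rewrite card_set_fin -sum1_card natr_sum big_mkcond /=.
  over.
rewrite exchange_big mulr_sumr /=.
rewrite (perm_big vr); last first.
  apply: uniq_perm => //; first exact: index_enum_uniq.
  by move=> v; rewrite [RHS](vr_all v); exact: (@mem_index_enum ('rV[T]_m : finType) v).
apply: eq_bigr => v _.
transitivity ((#|T|%:R ^+ #|I|)^-1 *
    #|[set z : {ffun I -> T} | v *m spec z == 0]%SET|%:R : rat).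
  by congr (_ * _); rewrite -sum1dep_card natr_sum [RHS]big_mkcond.
pose f (z : {ffun I -> T}) : 'rV[T]_n := v *m spec z.
have f0 : f (0 : {ffun I -> S}) = 0.
  have spec0 : spec (0 : {ffun I -> S}) = 0.
    by apply: (addrI (spec 0)); rewrite -specializeD !addr0.
  by rewrite /f spec0 mulmx0.
have fD x y : f ((x : {ffun I -> S}) + y) = (f x : 'rV[S]_n) + f y.
  by rewrite /f specializeD mulmxDr.
have fE x y : (f ((y : {ffun I -> S}) + x) == f y) = (f x == f (0 : {ffun I -> S})).
  by rewrite fD f0 -[X in _ == X](addr0 (f y : 'rV[S]_n)) (inj_eq (addrI _)).
have := @card_fibers _ _ f (0 : {ffun I -> S}) (fun y x => (y : {ffun I -> S}) + x)
  (fun y => @addrI _ y) fE.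
have -> : #|(f @: {ffun I -> T})%SET| = (\prod_(c < n) size (s v c))%N.
  pose G (c : 'I_n) : pred T := fun t => t \in s v c.
  have <- : #|family G| = (\prod_(c < n) size (s v c))%N.
    rewrite card_family foldrE big_map big_enum /=; apply: eq_bigr => c _.
    rewrite -(elimT (@card_uniqP T (s v c)) (s_uniq v c)); exact: eq_card.
  rewrite -(card_imset _ (_ : injective (fun g : {ffun 'I_n -> T} => \row_c g c : 'rV[T]_n))).
    apply: eq_card => u; apply/imsetP/imsetP => [[z _ ->]|[g gG ->]].
      exists [ffun c => f z 0 c].
        have H : forall c, (f z : 'rV[S]_n) 0 c \in s v c.
          by apply/image_spec; exists z.
        by apply/familyP => c; rewrite ffunE; apply: H.
      by apply/rowP => c; rewrite mxE ffunE.
    have /image_spec[z zE] : forall c, (\row_c g c : 'rV[S]_n) 0 c \in s v c.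
      by move=> c; rewrite mxE; move/familyP: gG; apply.
    by exists z.
  by move=> g g' /rowP E; apply/ffunP => c; have := E c; rewrite !mxE.
rewrite card_ffun => E; rewrite -natrX E natrM.
pose z0 : {ffun I -> S} := 0.
have k0 : (0 < #|[set x | f x == f z0]%SET|)%N.
  by apply/card_gt0P; exists z0; rewrite inE.
have -> : #|[set z : {ffun I -> T} | v *m spec z == 0]%SET| =
          #|[set x | f x == f (0 : {ffun I -> S})]%SET|.
  by apply: eq_card => z; rewrite !inE f0.
rewrite invfM mulrAC mulVf ?mul1r // pnatr_eq0; lia.
Qed.

End FiniteAsk.

(** * The average kernel size as a weighted sum over vectors *)

(** The indices satisfying a decreasing predicate form an initial segment, so counting them finds
    the last one, capped at [k]. *)
Lemma last_level (P : nat -> bool) (k : nat) (m := (\sum_(j < k) P j.+1)%N) :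
  (forall j, P j.+1 -> P j) -> P 0 ->
  [/\ (m <= k)%N, P m & (m < k)%N -> ~~ P m.+1].
Proof.
move=> P_dec P0; rewrite /m {m}; elim: k => [|k [le_mk Pm PNm]].
  by rewrite big_ord0.
rewrite big_ord_recr /=; set m := (\sum_(j < k) P j.+1)%N in le_mk Pm PNm *.
have Ple i j : (i <= j)%N -> P j -> P i.
  by move=> /subnK <-; elim: (j - i)%N => // n IH; rewrite addSn => /P_dec.
have [mk|km] := ltnP m k.
  case Pk: (P k.+1); first by have := PNm mk; rewrite (Ple _ _ _ Pk) // ltnS ltnW.
  by rewrite addn0; split=> //; [apply: leqW | move=> _; apply: PNm].
have mk : m = k by apply/eqP; rewrite eqn_leq le_mk.
rewrite mk in Pm *; case Pk: (P k.+1); rewrite ?addn1 ?addn0; split=> //.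
- by rewrite ltnn.
- by rewrite Pk.
Qed.

Section AskSum.
Variables (K : fieldType) (d : nat) (A : {fset {vspace 'rV[K]_d}}).
Local Notation LA := (intposet fullv A).
Variables (R : comNzRingType) (L : A -> 'cV[R]_d) (mu : LA -> nat).
Variables (o : idomainType) (p : o).
Hypothesis p_neq0 : p != 0.
Hypothesis p_max : forall x, max_ideal x <-> exists a, x = a * p.
Variable phi : {rmorphism R -> o}.
Variables (Fq : finFieldType) (red : {rmorphism o -> Fq}).
Hypothesis red_residue : is_residue_field red.
Local Notation M := (base_change phi (ask_matrix L mu)).
Implicit Types (v : 'rV[o]_d) (H : A) (x : LA) (k j : nat).

Definition form_val v H : o := (v *m map_mx phi (L H)) 0 0.

Definition divisible_forms j v : {set A} :=
  [set H : A | `[< exists a, form_val v H = a * p ^+ j >]].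

Lemma divisible_formsP j v H :
  reflect (exists a, form_val v H = a * p ^+ j) (H \in divisible_forms j v).
Proof. by rewrite inE; apply: asboolP. Qed.

Lemma divisible_forms0 v : divisible_forms 0 v = finset.setT.
Proof.
by apply/setP => H; rewrite [RHS]inE; apply/divisible_formsP;
   exists (form_val v H); rewrite mulr1.
Qed.

Lemma divisible_formsS j v : divisible_forms j.+1 v \subset divisible_forms j v.
Proof.
apply/fintype.subsetP => H /divisible_formsP[a E]; apply/divisible_formsP.
by exists (a * p); rewrite E exprS mulrA.
Qed.

Lemma form_valD v v' H : form_val (v + v') H = form_val v H + form_val v' H.
Proof. by rewrite /form_val mulmxDl mxE. Qed.

Lemma form_valZ a v H : form_val (a *: v) H = a * form_val v H.
Proof. by rewrite /form_val -scalemxAl mxE. Qed.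

Lemma divisible_forms_congr j k v u : (j <= k)%N ->
  divisible_forms j (v + p ^+ k *: u) = divisible_forms j v.
Proof.
move=> jk; apply/setP => H; apply/divisible_formsP/divisible_formsP => -[a E].
  exists (a - form_val u H * p ^+ (k - j)).
  rewrite mulrBl -E form_valD form_valZ -mulrA -exprD subnK //.
  by rewrite [p ^+ k * _]mulrC addrK.
exists (a + form_val u H * p ^+ (k - j)).
rewrite mulrDl -E form_valD form_valZ -mulrA -exprD subnK //.
by rewrite [p ^+ k * _]mulrC.
Qed.

(** The least valuation of [form_val v H] over the [H] containing [x], capped at [k], and [k] itself
    if there is no such [H]. Written as a count, it makes [k - level] the number of levels where [x]
    fails, ready for an exchange of sums. *)
Definition level k x v : nat :=
  (\sum_(j < k) (containing A (flat_space x) \subset divisible_forms j.+1 v))%N.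

Lemma level_congr k x v u : level k x (v + p ^+ k *: u) = level k x v.
Proof. by apply: eq_bigr => j _; rewrite divisible_forms_congr. Qed.

Lemma levelP k x v (m := level k x v) :
  [/\ (m <= k)%N, containing A (flat_space x) \subset divisible_forms m v &
    (m < k)%N -> ~~ (containing A (flat_space x) \subset divisible_forms m.+1 v)].
Proof.
apply: (@last_level (fun j => _ \subset divisible_forms j v)) => [j sj|].
  exact: fintype.subset_trans sj (divisible_formsS j v).
by rewrite divisible_forms0 finset.subsetT.
Qed.

Section Residue.
Variable k : nat.
Local Notation S := (residue_ring o k).
Local Notation res := (@residue_map o k).
Local Notation spec z := (specialize (base_change res M) z).

(** Column [c] involves only the variables attached to [c], so the coordinates of the product vary
    independently. *)
Lemma mulmx_spec v (z : {ffun var_index mu -> S}) c :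
  (map_mx res v *m spec z) 0 c =
  \sum_(w : var_index mu | (val w).2 == enum_val c)
    res (form_val v (val w).1) * z w.
Proof.
rewrite mxE; under eq_bigr do rewrite [X in _ * X]mxE mulr_sumr.
rewrite exchange_big [RHS]big_mkcond /=; apply: eq_bigr => w _.
have E (j : 'I_d) : (base_change res M) j c w =
    if (val w).2 == enum_val c then res (phi (L (val w).1 j 0)) else 0.
  rewrite !mxE !ffunE sum_ffunE.
  under eq_bigr do rewrite !ffunE.
  rewrite big_mkcond (bigD1 w) //= big1 ?addr0 => [|w' w'w].
    by case: ifP => _; rewrite ?rmorph0 // eqxx [_ *: _]mulr1.
  by case: ifP => // _; rewrite eq_sym (negPf w'w) scaler0.
under eq_bigr do rewrite E.
case: ifP => _; last by rewrite big1 // => j _; rewrite mul0r mulr0.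
rewrite /form_val mxE rmorph_sum mulr_suml; apply: eq_bigr => j _.
by rewrite rmorphM mulrA !mxE.
Qed.

Let lift (t : 'rV[S]_d) : 'rV[o]_d := map_mx repr t.

Let liftK t : map_mx res (lift t) = t.
Proof. by apply/rowP => j; rewrite !mxE residue_mapK. Qed.

Let image_list (t : 'rV[S]_d) (c : 'I_#|{: col_index mu}|) : seq S :=
  let m := level k (tag (enum_val c)) (lift t) in
  [seq res (p ^+ m * a) | a <- scal_reps p red_residue (k - m)].

Let image_listP t (u : 'rV[S]_#|{: col_index mu}|) :
  (exists z, t *m spec z = u) <-> forall c, u 0 c \in image_list t c.
Proof.
have in_list c s : reflect
    (exists b, s = res (p ^+ level k (tag (enum_val c)) (lift t)) * b)
    (s \in image_list t c).
  by apply: multiples_reps => //; have [] := levelP k (tag (enum_val c)) (lift t).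
split=> [[z <-] c|H].
  apply/in_list; rewrite -[in t *m _](liftK t) mulmx_spec.
  apply: (big_ind (fun s => exists b, s = _ * b)) => [|s s' [b ->] [b' ->]|w /eqP wc].
  - by exists 0; rewrite mulr0.
  - by exists (b + b'); rewrite mulrDr.
  have [_ /fintype.subsetP sub _] := levelP k (tag (enum_val c)) (lift t).
  have /sub/divisible_formsP[a ->] : (val w).1 \in
      containing A (flat_space (tag (enum_val c))).
    by have := valP w; rewrite /localization wc !inE /= => /andP[].
  by exists (res a * z w); rewrite rmorphM mulrAC mulrC mulrA.
have Z c : exists z : {ffun var_index mu -> S},
    \sum_(w : var_index mu | (val w).2 == enum_val c)
      res (form_val (lift t) (val w).1) * z w = u 0 c.
  have /in_list[b ->] := H c.
  have [] := levelP k (tag (enum_val c)) (lift t).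
  (* If [m = k] the ideal is zero. Otherwise some form has valuation exactly [m], and its variable
     alone reaches every multiple of [p ^+ m]. *)
  set m := level k _ _; rewrite leq_eqVlt => /orP[/eqP mk _ _|mk sub /(_ mk)].
    exists [ffun=> 0]; rewrite big1 => [|w _]; last by rewrite ffunE mulr0.
    have /(residue_map_eq0 p_max) -> : exists a, p ^+ m = a * p ^+ k.
      by exists 1; rewrite mul1r mk.
    by rewrite mul0r.
  move=> /subsetPn[G Gx GN]; have /divisible_formsP[a aE] := fintype.subsetP sub _ Gx.
  have a_unit : a \is a GRing.unit.
    apply/negPn/negP => /p_max[a' a'E]; move/negP: GN; apply; apply/divisible_formsP.
    by exists a'; rewrite aE a'E exprS mulrA.
  have wP : fsval (G, enum_val c).1 \in
      localization A (flat_space (tag (G, enum_val c).2)).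
    by rewrite /localization !inE /= (valP G) /=; rewrite inE in Gx.
  pose w : var_index mu := exist _ (G, enum_val c) wP.
  exists [ffun w' => if w' == w then res a^-1 * b else 0].
  rewrite (bigD1 w) /=; last exact: eqxx.
  rewrite big1 => [|w' /andP[_ /negPf w'w]]; last by rewrite ffunE w'w mulr0.
  rewrite ffunE eqxx addr0 aE mulrA -rmorphM; congr (res _ * b).
  by rewrite mulrAC mulrV // mul1r.
have [Zf ZfE] := choice Z.
(* Solutions for the columns can be glued, as each variable belongs to exactly one column. *)
exists [ffun w : var_index mu => Zf (enum_rank (val w).2) w].
rewrite -[in t *m _](liftK t); apply/rowP => c; rewrite mulmx_spec.
rewrite -ZfE; apply: eq_bigr => w /eqP wc.
by rewrite ffunE wc enum_valK.
Qed.

Let ask_product : ask res M = \sum_(v <- vec_reps p red_residue d k)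
   ((\prod_(x : LA) (#|Fq| ^ (k - level k x v)) ^ mu x)%N%:R)^-1.
Proof.
rewrite (ask_images (scal_reps_uniq p_neq0 p_max red_residue k)
  (fun t => mem_scal_reps p_max red_residue t) (vec_reps_uniq p_neq0 p_max red_residue d k)
  (fun t => mem_vec_reps p_max red_residue t) (s := image_list) _ image_listP); last first.
  move=> t c; apply: multiples_reps_uniq => //.
  by have [] := levelP k (tag (enum_val c)) (lift t).
rewrite big_map; apply: eq_bigr => v _; congr (_%:R^-1).
(* [image_list] uses the representative given by [repr], the sum another one; they agree modulo
   [p ^+ k], which is all that [level] sees. *)
have level_lift x : level k x (lift (map_mx res v)) = level k x v.
  have H (j : 'I_d) : exists u, repr (res (v 0 j)) - v 0 j = u * p ^+ k.
    by apply/(residue_map_eq p_max); rewrite residue_mapK.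
  have -> : lift (map_mx res v) = v + p ^+ k *: \row_j sval (cid (H j)).
    apply/rowP => j; rewrite !mxE mulrC -(svalP (cid (H j))).
    by rewrite addrC subrK.
  exact: level_congr.
under eq_bigr => c _ do rewrite size_map size_scal_reps level_lift.
rewrite -(big_enum_val (fun e : col_index mu => #|Fq| ^ (k - level k (tag e) v)))%N /=.
rewrite (eq_bigr (fun x => \prod_(i < mu x) #|Fq| ^ (k - level k x v)))%N; last first.
  by move=> x _; rewrite prod_nat_const card_ord.
by rewrite sig_big_dep /=; apply: eq_bigr => -[].
Qed.

Lemma ask_weights : ask res M = \sum_(v <- vec_reps p red_residue d k)
  \prod_(j < k) (#|Fq|%:R ^+ (\sum_(x : LA |
    ~~ (containing A (flat_space x) \subset divisible_forms j.+1 v)) mu x)%N)^-1.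
Proof.
rewrite ask_product; apply: eq_bigr => v _.
rewrite prodfV; congr (_^-1).
rewrite prodrXr -natrX; congr (_%:R).
rewrite (eq_bigr (fun x => #|Fq| ^ ((k - level k x v) * mu x))%N); last first.
  by move=> x _; rewrite expnM.
rewrite -expn_sum; congr (_ ^ _)%N.
rewrite [RHS](exchange_big_dep predT) //=; apply: eq_bigr => x _.
rewrite sum_nat_cond_const; congr (_ * _)%N.
have k1 : (\sum_(j < k) 1)%N = k by rewrite sum_nat_const card_ord muln1.
rewrite /level -[X in (X - _)%N]k1.
rewrite -sumnB => [|j _]; last exact: leq_b1.
rewrite -sum1_card [RHS]big_mkcond; apply: eq_bigr => j _ /=.
by rewrite ?inE; case: (_ \subset _).
Qed.


End Residue.
End AskSum.

(** * Recursion over the levels *)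

Section Recursion.
Variables (K : fieldType) (d : nat) (A : {fset {vspace 'rV[K]_d}}).
Hypothesis A_arr : arrangement_in fullv A.
Variables (R : comNzRingType) (iota : {rmorphism R -> K}).
Hypothesis iota_inj : injective iota.
Variable L : A -> 'cV[R]_d.
Hypothesis L_locus : forall H : A, zero_locus (map_mx iota (L H)) = fsval H.
Variable o : idomainType.
Variable p : o.
Hypothesis p_neq0 : p != 0.
Hypothesis p_max : forall x, max_ideal x <-> exists a, x = a * p.
Variable phi : {rmorphism R -> o}.
Variables (Fq : finFieldType) (red : {rmorphism o -> Fq}).
Hypothesis red_residue : is_residue_field red.
Variable psi : {rmorphism R -> Fq}.
Hypothesis psiE : forall x, psi x = red (phi x).
Hypothesis A_good : good_reduction L psi.
Local Notation LA := (intposet fullv A).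
Variable mu : LA -> nat.
Local Notation X := (common_zeros (fun H : A => map_mx iota (L H))).
Local Notation D := (divisible_forms L p phi).
Local Notation val_at := (form_val L phi).
Local Notation q := #|Fq|.
Implicit Types (B : {set A}) (v : 'rV[o]_d) (H : A) (x y z : LA) (j k : nat).

Definition flat_at k v : LA := flat_of L_locus (D k v).

(** A form dependent over [K] on those in [B] has a unit multiple in their span over [o], so it
    inherits their divisibility. Hence [D k v] is determined by a flat. *)
Lemma divisible_forms_closure k v B H :
  B \subset D k v -> (X B <= fsval H)%VS -> H \in D k v.
Proof.
move=> /fintype.subsetP Bk XB; apply/divisible_formsP.
have [_ _ span _] := good_arrangement A_arr iota_inj L_locus A_good B.
have [e [b [E]]] := span H XB; rewrite psiE => eU.
have {}eU : phi e \is a GRing.unit by apply: red_unit eU.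
have E' : phi e * val_at v H = \sum_(H' in B) phi (b H') * val_at v H'.
  have := congr1 (fun c => (v *m map_mx phi c) 0 0) E.
  rewrite map_mxZ -scalemxAr mxE => ->.
  rewrite raddf_sum mulmx_sumr summxE; apply: eq_bigr => H' _.
  by rewrite /= map_mxZ -scalemxAr mxE.
suff [a aE] : exists a, \sum_(H' in B) phi (b H') * val_at v H' = a * p ^+ k.
  exists ((phi e)^-1 * a); rewrite -mulrA -aE -E'.
  by rewrite mulrA mulVr // mul1r.
apply: (big_ind (fun s => exists a, s = a * p ^+ k)) => [|s t [a ->] [a' ->]|H' /Bk].
- by exists 0; rewrite mul0r.
- by exists (a + a'); rewrite mulrDl.
by move=> /divisible_formsP[a ->]; exists (phi (b H') * a); rewrite mulrA.
Qed.

Lemma containing_flat_at k v : containing A (flat_space (flat_at k v)) = D k v.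
Proof.
apply/setP => H; rewrite inE; apply/idP/idP => [|Hk].
  exact: divisible_forms_closure.
by rewrite -L_locus; apply: (common_zeros_le (fun H : A => map_mx iota (L H))).
Qed.

Lemma le_flat_at k v x :
  (x <= flat_at k v)%O = (containing A (flat_space x) \subset D k v).
Proof.
rewrite flat_leE; apply/idP/idP => [|sub]; last first.
  by rewrite -(common_zeros_containing L_locus x); apply: common_zerosS.
by rewrite -containing_flat_at; apply: containingS.
Qed.

Definition weight_exponent z : nat := (\sum_(x : LA | ~~ (x <= z)%O) mu x)%N.

Definition weight k v : rat :=
  \prod_(j < k) (q%:R ^+ weight_exponent (flat_at j.+1 v))^-1.

(** [None] serves the last factor of a flag, where the localization is all of [A]. *)
Definition stratum_weight (y : option LA) z : rat :=
  (map_poly intr (poincare (flat_space z)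
    (restriction (localization_opt y) (flat_space z)))).[- (q%:R)^-1].

Definition level_sum k z : rat :=
  \sum_(v <- vec_reps p red_residue d k | flat_at k v == z) weight k v.

Lemma ask_level_sum k :
  ask (@residue_map o k) (base_change phi (ask_matrix L mu)) =
  \sum_z level_sum k z.
Proof.
rewrite (ask_weights L mu p_neq0 p_max phi red_residue k).
rewrite (partition_big (flat_at k) predT) //=.
apply: eq_bigr => z _; apply: eq_bigr => v _; apply: eq_bigr => j _.
congr ((_ ^+ _)^-1); apply: eq_bigl => x.
by rewrite -le_flat_at.
Qed.

Definition center : LA := flat_of L_locus finset.setT.

Lemma level_sum0 z : level_sum 0 z = (center == z)%:R.
Proof.
rewrite /level_sum /vec_reps /= big_cons big_nil /weight big_ord0.
by rewrite /flat_at divisible_forms0 -/center; case: eqP => _; rewrite ?addr0.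
Qed.

(** Links the two recursions: the digits start at [center], whereas a flag ends at the formal upper
    bound [None]. *)
Lemma stratum_weight_center z : stratum_weight (Some center) z = stratum_weight None z.
Proof.
rewrite /stratum_weight; suff -> : localization_opt (Some center) = A by [].
apply/fsetP => G; rewrite /= /localization !inE /=; case GA: (G \in A) => //=.
have /subv_trans -> // : (flat_space center <= zero_locus (map_mx iota (L (FSetSub GA))))%VS.
  exact: (common_zeros_le (fun H : A => map_mx iota (L H)) (finset.in_setT _)).
by rewrite L_locus.
Qed.

Lemma form_val_red v H : red (val_at v H) = (map_mx red v *m map_mx psi (L H)) 0 0.
Proof.
rewrite /form_val !mxE rmorph_sum; apply: eq_bigr => j _.
by rewrite rmorphM !mxE psiE.
Qed.

(** Residues can be prescribed only on an independent subset [C]. There they cancel the leading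
    digits of the forms; the other forms follow by closure. *)
Lemma solve_next_level k v : exists w0 : 'rV[Fq]_d,
  containing A (flat_space (flat_at k v)) \subset
    D k.+1 (v + p ^+ k *: lift_row red_residue w0).
Proof.
set B := containing _ _.
have [_ _ _ [C CB [XC solve]]] := good_arrangement A_arr iota_inj L_locus A_good B.
have BD : B = D k v by apply: containing_flat_at.
have Ck H : exists a, H \in C -> val_at v H = a * p ^+ k.
  have [HC|HC] := boolP (H \in C); last by exists 0.
  have : H \in B by apply: fintype.subsetP CB _ HC.
  by rewrite BD => /divisible_formsP[a aE]; exists a.
have [a aE] := choice Ck.
have [w0 w0E] := solve (fun H => - red (a H)).
exists w0; apply/fintype.subsetP => H HB.
apply: (@divisible_forms_closure _ _ C); last first.
  by rewrite XC; move: HB; rewrite /B (common_zeros_containing L_locus) inE.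
apply/fintype.subsetP => G GC; apply/divisible_formsP.
rewrite form_valD form_valZ aE // [p ^+ k * _]mulrC -mulrDl.
have /(red_eq0 p_max red_residue)[b ->] :
    red (a G + val_at (lift_row red_residue w0) G) = 0.
  by rewrite rmorphD form_val_red map_lift_row w0E // !mxE eqxx mulr1n addrN.
by exists b; rewrite exprS mulrA.
Qed.

(* After a translation by w0 the digits w leading from y to z are the points of *)
(* the stratum of z in the reduction of the localization at y.                  *)
Lemma card_next_flat k v z (y := flat_at k v) :
  #|[set w : 'rV[Fq]_d |
     flat_at k.+1 (v + p ^+ k *: lift_row red_residue w) == z]|%:R =
  if (z <= y)%O then q%:R ^+ \dim (flat_space z) * stratum_weight (Some y) z
  else 0.
Proof.
have [w0 /fintype.subsetP w0y] := solve_next_level k v.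
set lift := @lift_row _ _ _ red_residue d in w0y *.
have nextE w : D k.+1 (v + p ^+ k *: lift w) =
    containing A (flat_space y) :&: vanishing L psi (w - w0).
  have dE H : H \in containing A (flat_space y) ->
      (H \in D k.+1 (v + p ^+ k *: lift w)) = (H \in vanishing L psi (w - w0)).
    move=> /w0y/divisible_formsP[a aE].
    have E : val_at (v + p ^+ k *: lift w) H =
        (a * p + val_at (lift w - lift w0) H) * p ^+ k.
      rewrite mulrDl -mulrA -exprS -aE !form_valD !form_valZ -scaleN1r form_valZ.
      ring.
    have -> : (H \in vanishing L psi (w - w0)) = (red (val_at (lift w - lift w0) H) == 0).
      rewrite form_val_red map_mxB !map_lift_row inE.
      apply/eqP/eqP => [->|E0]; first by rewrite mxE.
      by apply/matrixP => i j; rewrite !ord1 E0 mxE.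
    apply/divisible_formsP/eqP => [[b]|/(red_eq0 p_max red_residue)[b bE]].
      rewrite E exprS mulrA => /(mulIf (expf_neq0 k p_neq0)) bE.
      by apply/(red_eq0 p_max red_residue); exists (b - a); rewrite mulrBl -bE addrAC subrr add0r.
    by exists (a + b); rewrite E bE -mulrDl -mulrA -exprS.
  apply/setP => H; rewrite [RHS]inE.
  have [Hy|Hy] := boolP (H \in containing A (flat_space y)); first exact: dE.
  (* Outside the localization at [y], divisibility already fails at level [k], and the new digit
     cannot repair it. *)
  apply: contraNF Hy => Hk; rewrite containing_flat_at.
  have := fintype.subsetP (divisible_formsS L p phi k _) _ Hk.
  by rewrite divisible_forms_congr.
have -> : #|[set w | flat_at k.+1 (v + p ^+ k *: lift w) == z]| =
    #|[set w | X (containing A (flat_space y) :&: vanishing L psi w) == flat_space z]|.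
  rewrite -[RHS](card_imset _ (addrI w0)); apply: eq_card => w; rewrite inE.
  have E u : (flat_at k.+1 (v + p ^+ k *: lift u) == z) =
      (X (containing A (flat_space y) :&: vanishing L psi (u - w0)) == flat_space z).
    by rewrite -nextE; apply/eqP/eqP => [<-//|E]; apply: val_inj.
  rewrite E; apply/idP/imsetP => [wE|[u]].
    by exists (w - w0); rewrite ?inE // addrC subrK.
  by rewrite inE => uE ->; rewrite addrC addKr.
case: ifPn => [zy|zy].
  exact: (card_stratum A_arr iota_inj L_locus A_good zy).
rewrite (eq_card0 (A := [set w | _])) // => w; rewrite !inE.
apply: contraNF zy => /eqP wz; rewrite flat_leE -wz.
rewrite -[X in (X <= _)%VS](common_zeros_containing L_locus y).
exact/common_zerosS/finset.subsetIl.
Qed.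

Lemma weightS k v w : weight k.+1 (v + p ^+ k *: lift_row red_residue w) =
  weight k v *
  (q%:R ^+ weight_exponent (flat_at k.+1 (v + p ^+ k *: lift_row red_residue w)))^-1.
Proof.
rewrite /weight big_ord_recr /=; congr (_ * _); apply: eq_bigr => j _.
by rewrite /flat_at divisible_forms_congr.
Qed.

Lemma level_sumS k z :
  level_sum k.+1 z = q%:R ^+ \dim (flat_space z) / q%:R ^+ weight_exponent z *
    \sum_(y | (z <= y)%O) stratum_weight (Some y) z * level_sum k y.
Proof.
rewrite /level_sum big_mkcond /vec_reps sum_digit_reps -/(vec_reps p red_residue d k).
pose c := (q%:R ^+ weight_exponent z)^-1 : rat.
transitivity (\sum_(v <- vec_reps p red_residue d k) weight k v * c *
    #|[set w : 'rV[Fq]_d |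
       flat_at k.+1 (v + p ^+ k *: lift_row red_residue w) == z]|%:R).
  apply: eq_bigr => v _.
  rewrite mulr_natr -sumr_const [RHS]big_mkcond /=; apply: eq_bigr => w _.
  by rewrite inE; case: eqP => // E; rewrite weightS E.
under eq_bigr do rewrite card_next_flat.
rewrite [LHS](partition_big (flat_at k) predT) //= mulr_sumr [RHS]big_mkcond /=.
apply: eq_bigr => y _; case: ifPn => zy; last first.
  rewrite big1 // => v /eqP vy; rewrite vy (negPf zy) mulr0 //.
rewrite !mulr_sumr; apply: eq_bigr => v /eqP vy; rewrite vy zy /c.
have mulE (a b e f : rat) : a * b * (e * f) = e * b * (f * a) by ring.
exact: mulE.
Qed.

Lemma weight_ge0 k v : 0 <= weight k v.
Proof. by apply: prodr_ge0 => j _; rewrite invr_ge0 exprn_ge0. Qed.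

Lemma level_sum_ge0 k z : 0 <= level_sum k z.
Proof. by apply: sumr_ge0 => v _; apply: weight_ge0. Qed.

Lemma card_Fq_gt0 : (0 < q)%N.
Proof. by apply/card_gt0P; exists 0. Qed.

Lemma weight_le1 k v : weight k v <= 1.
Proof.
apply: prodr_ile1 => j _; rewrite invr_ge0 exprn_ge0 //=.
by rewrite invf_le1 ?exprn_gt0 ?exprn_ege1 ?ler1n ?ltr0n ?card_Fq_gt0.
Qed.

(** There are [q ^ (d * k)] representatives, each of weight at most 1. This crude bound yields the
    half-plane of convergence. *)
Lemma sum_level_sum_le k : \sum_z level_sum k z <= (q ^ (d * k))%:R.
Proof.
have -> : \sum_z level_sum k z = \sum_(v <- vec_reps p red_residue d k) weight k v.
  by rewrite [RHS](partition_big (flat_at k) predT).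
apply: (@le_trans _ _ (\sum_(v <- vec_reps p red_residue d k) 1)).
  by apply: ler_sum => v _; apply: weight_le1.
rewrite big_const_seq count_predT size_digit_reps iter_addr_0.
by rewrite card_mx mul1n expnM.
Qed.

End Recursion.

(** * The flag series *)

Lemma big_tuple_cons (E : nmodType) (T : finType) (n : nat)
    (P : pred (n.+1.-tuple T)) (G : n.+1.-tuple T -> E) :
  \sum_(f : n.+1.-tuple T | P f) G f =
  \sum_x \sum_(f : n.-tuple T | P [tuple of x :: f]) G [tuple of x :: f].
Proof.
rewrite pair_big_dep /= (reindex (fun u : T * n.-tuple T => [tuple of u.1 :: u.2])).
  by [].
exists (fun f => (thead f, [tuple of behead f])) => [[x f] _|f _] /=.
  by congr (_, _); apply: val_inj.
by rewrite [RHS]tuple_eta.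
Qed.

(** No hyperplane is the whole space, so restricting to the bottom flat removes nothing. This
    identifies the first factor of the flag polynomial with the divisor in [poincare_flag_red]. *)
Lemma restriction_fullv (F : fieldType) (d : nat) (A B : {fset {vspace 'rV[F]_d}}) :
  arrangement_in fullv A -> (B `<=` A)%fset -> restriction B fullv = B.
Proof.
move=> A_arr /fsubsetP BA; apply/fsetP => G; apply/imfsetP/idP => [[H /= + ->]|GB].
  by rewrite capvf !inE => /andP[].
exists G; rewrite ?capvf // !inE GB /= andbT.
apply/negP => fG; have [_] := A_arr _ (BA _ GB).
have -> : G = fullv by apply/eqP; rewrite eqEsubv subvf.
by move/eqP; rewrite eqn_leq ltnn.
Qed.

(** Only the bottom flat has rank 0. The value shows that the divisor in [poincare_flag_red] is
    non-zero. *)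
Lemma poincare_at0 (F : fieldType) (d : nat) (U : {vspace 'rV[F]_d})
    (B : {fset {vspace 'rV[F]_d}}) : (poincare U B).[0] = 1.
Proof.
rewrite /poincare horner_sum (bigD1 (flat0 U B)) //= big1 ?addr0 => [|x x0].
  by rewrite mobiusE eqxx mul1r /rk subnn expr0 hornerC.
rewrite hornerM horner_exp hornerN hornerX oppr0 expr0n.
have := flat0_le x; rewrite flat_leE => xU.
case: eqP => [/eqP|_]; last by rewrite mulr0.
rewrite /rk subn_eq0 => Ux; case/eqP: x0; apply: val_inj; apply/eqP.
by rewrite eqEdim; apply/andP.
Qed.

Lemma poincare_empty (F : fieldType) (d : nat) (U : {vspace 'rV[F]_d}) :
  poincare U fset0 = 1.
Proof.
rewrite /poincare (big_pred1 (flat0 U fset0)) => [|x].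
  by rewrite mobiusE eqxx mul1r /rk subnn expr0.
rewrite /=; apply/esym/eqP; apply: val_inj; apply/vspaceP => v.
have /intersectionsP[B /fsubsetP B0 ->] := valP x.
suff -> : B = fset0 by rewrite andbT.
by apply/fsetP => G; rewrite [RHS]inE; apply/negP => /B0.
Qed.

Section FlagSum.
Variables (K : fieldType) (d : nat) (A : {fset {vspace 'rV[K]_d}}).
Hypothesis A_arr : arrangement_in fullv A.
Variable Fq : finFieldType.
Local Notation LA := (intposet fullv A).
Local Notation sw := (@stratum_weight _ _ A Fq).
Local Notation qm := (- (#|Fq|%:R)^-1).
Implicit Types (f : seq LA) (x y z : LA).

Fixpoint flag_weight f : rat :=
  if f is x :: f' then sw (ohead f') x * flag_weight f' else 1.

Lemma localization_opt_sub (y : option LA) : (localization_opt y `<=` A)%fset.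
Proof.
by case: y => [y|] //=; apply/fsubsetP => H; rewrite !inE => /andP[].
Qed.

Lemma poincare_flag_redE f : (poincare_flag_red f).[qm] = flag_weight f.
Proof.
pose P f : {poly int} := \prod_(i < size f)
  poincare (flat_space (nth (flat0 fullv A) f i))
    (restriction (localization_opt (nth None (map Some f) i.+1))
                 (flat_space (nth (flat0 fullv A) f i))).
have -> : poincare_flag_red f = map_poly intr (P f).
  rewrite /poincare_flag_red /poincare_flag big_ord_recl /=.
  rewrite (_ : flag_upper f 0 = flag_min f); last by case: f.
  rewrite (restriction_fullv A_arr (localization_opt_sub _)) rmorphM mulKp //.
  apply/eqP => /(congr1 (fun r : {poly rat} => r.[0%:~R])).
  by rewrite horner_map horner0 poincare_at0.
elim: f => [|x f IH]; first by rewrite /P big_ord0 rmorph1 hornerC.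
rewrite /P big_ord_recl rmorphM hornerM /= -IH; congr (_ * _).
by rewrite /stratum_weight; case: (f).
Qed.

Section Sum.
Variables (C : numFieldType) (T : LA -> C).
Local Notation w := (fun x => T x / (1 - T x)).
Local Notation N := #|{: LA}|.

Let F f : C := ratr (flag_weight f) * \prod_(x <- f) w x.
Let g l z : C := \sum_(f : l.-tuple LA | sorted <%O (z :: f)) F (z :: f).

Let g0 z : g 0 z = w z * ratr (sw None z).
Proof.
rewrite /g (big_pred1 [tuple]) => [|f]; last by rewrite tuple0.
by rewrite /F /= mulr1 big_seq1 mulrC.
Qed.

Let gS l z : g l.+1 z = w z * \sum_(y | (z < y)%O) ratr (sw (Some y) z) * g l y.
Proof.
rewrite /g big_tuple_cons mulr_sumr [RHS]big_mkcond; apply: eq_bigr => y _ /=.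
case: ifPn => zy; last by rewrite big_pred0.
rewrite /= !mulr_sumr; apply: eq_bigr => f _.
by rewrite /F /= big_cons rmorphM /=; ring.
Qed.

(** A chain of [N.+1] flats cannot exist, so the recursion on the length closes up. *)
Let gN z : g N z = 0.
Proof.
rewrite /g big_pred0 // => f; apply/negP => zf.
have /card_uniqP : uniq (z :: f) by apply: lt_sorted_uniq zf.
have := max_card (mem (z :: f)); rewrite /= size_tuple => + E.
by rewrite E ltnn.
Qed.

Lemma mfHP_recursion : exists G : LA -> C,
  mfHP (- (#|Fq|%:R)^-1) T = 1 + \sum_z G z /\
  forall z, G z =
    w z * (ratr (sw None z) + \sum_(y | (z < y)%O) ratr (sw (Some y) z) * G y).
Proof.
exists (fun z => \sum_(l < N) g l z); split=> [|z].
  rewrite /mfHP big_ord_recl /=; congr (_ + _).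
    rewrite (big_pred1 [tuple]) => [|f]; last by rewrite tuple0.
    by rewrite big_nil mulr1 -[RHS](rmorph1 (ratr : rat -> C)) -[1 in RHS]/(flag_weight [::])
      -poincare_flag_redE -horner_map /= rmorphN fmorphV rmorph_nat.
  rewrite exchange_big; apply: eq_bigr => l _ /=.
  rewrite big_tuple_cons; apply: eq_bigr => z _; apply: eq_bigr => f _.
  rewrite /F -poincare_flag_redE; congr (_ * _).
  by rewrite -horner_map /= rmorphN fmorphV rmorph_nat.
(* The vanishing term [g N z] makes room for the index shift: flags of one element split off and the
   rest has the old range. *)
transitivity (\sum_(l < N.+1) g l z).
  by rewrite big_ord_recr /= gN addr0.
rewrite big_ord_recl g0 mulrDr; congr (_ + _).
under eq_bigr do rewrite gS.
rewrite -mulr_sumr exchange_big /=; congr (_ * _); apply: eq_bigr => y _.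
by rewrite mulr_sumr.
Qed.

End Sum.

Lemma stratum_weight_diag z : sw (Some z) z = 1.
Proof.
rewrite /stratum_weight /= (_ : restriction _ _ = fset0) ?poincare_empty ?rmorph1 ?hornerC //.
apply/fsetP => G; rewrite inE; apply/negP => /imfsetP[H /= + _].
by rewrite /localization !inE /=; case: (H \in A) => //=; case: (_ <= _)%VS.
Qed.

End FlagSum.

(** * Summation of the recursion *)

Section WeightedSeries.
Local Open Scope classical_set_scope.
Variables (C : numFieldType) (disp : Order.disp_t) (T : finPOrderType disp).
Variables (top : T) (t : C) (c : T -> rat) (s : T -> T -> rat) (b : nat -> T -> rat).
Hypothesis top_max : forall z, (z <= top)%O.
Hypothesis c_gt0 : forall z, 0 < c z.
Hypothesis s_ge0 : forall y z, (z <= y)%O -> 0 <= s y z.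
Hypothesis s_diag : forall z, s z z = 1.
Hypothesis b0 : forall z, b 0 z = (top == z)%:R.
Hypothesis bS : forall k z, b k.+1 z = c z * \sum_(y | (z <= y)%O) s y z * b k y.
Hypothesis b_ge0 : forall k z, 0 <= b k z.

Let a k z : C := ratr (b k z) * t ^+ k.
Let tau z : C := t * ratr (c z).

Variable G : T -> C.
Hypothesis GE : forall z, G z = tau z / (1 - tau z) *
  (ratr (s top z) + \sum_(y | (z < y)%O) ratr (s y z) * G y).

Let a0 z : a 0 z = (top == z)%:R.
Proof. by rewrite /a b0 mulr1 ratr_nat. Qed.

Let aS k z : a k.+1 z =
  tau z * (a k z + \sum_(y | (z < y)%O) ratr (s y z) * a k y).
Proof.
rewrite /a bS (bigD1 z) //= s_diag mul1r.
have -> : \sum_(y | (z <= y)%O && (y != z)) s y z * b k y =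
          \sum_(y | (z < y)%O) s y z * b k y.
  by apply: eq_bigl => y; rewrite lt_neqAle andbC eq_sym.
rewrite rmorphM rmorphD rmorph_sum /= exprS /tau.
have -> : \sum_(y | (z < y)%O) ratr (s y z) * (ratr (b k y) * t ^+ k) =
    (\sum_(y | (z < y)%O) ratr (s y z * b k y)) * t ^+ k.
  by rewrite mulr_suml; apply: eq_bigr => y _; rewrite rmorphM /= mulrA.
set u := \sum_(_ | _) _; ring.
Qed.

Let norm_a k z : `|a k z| = ratr (b k z) * `|t| ^+ k.
Proof. by rewrite /a normrM normrX ger0_norm // ler0q. Qed.

(* No cancellation occurs as all a k z are non-negative multiples of t^k. *)
Let norm_a_le k z : `|a k z| <= `|\sum_z a k z|.
Proof.
rewrite norm_a -mulr_suml normrM normrX ler_wpM2r ?exprn_ge0 //.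
rewrite -rmorph_sum /= ger0_norm ?ler0q ?sumr_ge0 // ler_rat (bigD1 z) //=.
by rewrite lerDl sumr_ge0.
Qed.

Hypothesis a_cvg0 : (fun k => \sum_z a k z : C^o) @ \oo --> (0 : C^o).

Let a_cvg z : (fun k => a k z : C^o) @ \oo --> (0 : C^o).
Proof.
apply/cvgr0Pnorm_lt => e e0; move/cvgr0Pnorm_lt: a_cvg0 => /(_ e e0).
by apply: filterS => k; apply: le_lt_trans; apply: norm_a_le.
Qed.

(* For tau z = 1 the quotient tau z / (1 - tau z) is the junk value 0.  It is    *)
(* harmless: the norms of a k z then increase with k but tend to 0.             *)
Let a_eq0 k z : tau z = 1 -> a k z = 0.
Proof.
move=> tau1; apply/eqP; rewrite -normr_eq0; apply: contraT => ak.
have a_incr n : `|a k z| <= `|a (k + n) z|.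
  elim: n => [|n IH]; first by rewrite addn0.
  rewrite addnS; apply: (le_trans IH); rewrite !norm_a.
  have tc : `|t| * ratr (c z) = 1.
    by rewrite -[ratr (c z)]ger0_norm ?ler0q ?ltW // -normrM -/(tau z) tau1 normr1.
  have bI : ratr (c z) * ratr (b (k + n) z) <= ratr (b (k + n).+1 z) :> C.
    rewrite -rmorphM /= ler_rat bS ler_pM2l // (bigD1 z) //= s_diag mul1r.
    by rewrite lerDl; apply: sumr_ge0 => y /andP[zy _]; rewrite mulr_ge0 ?s_ge0.
  have -> : ratr (b (k + n) z) * `|t| ^+ (k + n) =
      ratr (c z) * ratr (b (k + n) z) * `|t| ^+ (k + n).+1.
    rewrite exprS mulrA [ratr (c z) * _]mulrC -[_ * _ * `|t|]mulrA.
    by rewrite [ratr (c z) * _]mulrC tc mulr1.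
  by rewrite ler_wpM2r // exprn_ge0.
have e0 : 0 < `|a k z| by rewrite lt0r ak normr_ge0.
move/cvgr0Pnorm_lt: (@a_cvg z) => /(_ _ e0)[n _ /(_ (k + n)%N)].
move=> /(_ (leq_addl _ _)) /=.
by move=> /(le_lt_trans (a_incr n)); rewrite ltxx.
Qed.

Let part n z : C := \sum_(k < n) a k z.

(** The sum of [n.+1] terms is split at its last and at its first term, and the two expressions are
    compared. *)
Let part_eq n z : (1 - tau z) * part n z =
  (top == z)%:R + tau z * (\sum_(y | (z < y)%O) ratr (s y z) * part n y) - a n z.
Proof.
have E1 : part n.+1 z = part n z + a n z by rewrite /part big_ord_recr.
have E2 : part n.+1 z = (top == z)%:R +
    tau z * (part n z + \sum_(y | (z < y)%O) ratr (s y z) * part n y).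
  rewrite /part big_ord_recl a0; congr (_ + _).
  under eq_bigr do rewrite aS.
  rewrite -mulr_sumr big_split /= exchange_big /=; congr (_ * (_ + _)).
  by apply: eq_bigr => y _; rewrite mulr_sumr.
move: E2; rewrite E1 => E.
have -> : a n z = (part n z + a n z) - part n z by rewrite addrC addKr.
by rewrite E; ring.
Qed.

Lemma part_cvg z :
  (fun n => \sum_(k < n) a k z : C^o) @ \oo --> ((top == z)%:R + G z : C^o).
Proof.
(* The induction descends from [top], on the number of elements above [z]. *)
have [n] := ubnP #|[pred y | (z < y)%O]|; elim: n z => // n IH z ltn.
have {}IH y : (z < y)%O ->
    (fun n => part n y : C^o) @ \oo --> ((top == y)%:R + G y : C^o).
  move=> zy; apply: IH; rewrite -ltnS; apply: leq_trans ltn.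
  apply: proper_card; apply/properP; split.
    by apply/fintype.subsetP => u; rewrite !inE; apply: lt_trans.
  by exists y; rewrite !inE ?ltxx.
have [tau1|tau1] := eqVneq (tau z) 1.
  rewrite GE tau1 subrr invr0 mulr0 mul0r addr0.
  rewrite -a0 a_eq0 //; apply: cvg_near_cst; near=> m.
  by rewrite big1 // => k _; apply: a_eq0.
have tau1' : 1 - tau z != 0 by rewrite subr_eq0 eq_sym.
have -> : (fun n => \sum_(k < n) a k z : C^o) = (fun n => (1 - tau z)^-1 *
    ((top == z)%:R + tau z * (\sum_(y | (z < y)%O) ratr (s y z) * part n y) - a n z)).
  by apply/funext => m; rewrite -part_eq mulKf.
have -> : (top == z)%:R + G z = (1 - tau z)^-1 * ((top == z)%:R + tau z *
    (\sum_(y | (z < y)%O) ratr (s y z) * ((top == y)%:R + G y)) - 0).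
  rewrite subr0 GE.
  under [in RHS]eq_bigr do rewrite mulrDr.
  rewrite big_split /=; set S1 := \sum_(_ | _) _ * G _.
  (* At [z = top] the sum is empty and [s_diag] makes the right side vanish; elsewhere only
     [y = top] contributes. *)
  have -> : \sum_(y | (z < y)%O) ratr (s y z) * (top == y)%:R =
      ratr (s top z) - (top == z)%:R :> C.
    have [<-|zt] := eqVneq top z.
      rewrite s_diag rmorph1 subrr big_pred0 // => y.
      by apply/negP => /lt_le_trans/(_ (top_max y)); rewrite ltxx.
    rewrite subr0 (bigD1 top) /=; last by rewrite lt_neqAle eq_sym zt top_max.
    rewrite eqxx mulr1 big1 ?addr0 // => y /andP[_].
    by rewrite eq_sym => /negPf ->; rewrite mulr0.
  by field.
apply: cvgMl_tmp; apply: cvgB; last exact: a_cvg.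
apply: cvgD; first exact: cvg_cst.
apply: cvgMl_tmp; apply: cvg_big => [|y zy]; first exact: add_continuous.
by apply: cvgMl_tmp; exact: IH.
Unshelve. all: by end_near.
Qed.

(** The terms at k = 0 are concentrated at [top]; their sum 1 is the contribution of the empty
    flag. *)
Lemma total_cvg :
  series (fun k => \sum_z a k z : C^o) @ \oo --> (1 + \sum_z G z : C^o).
Proof.
have -> : series (fun k => \sum_z a k z : C^o) =
    (fun n => \sum_z \sum_(k < n) a k z : C^o).
  by apply/funext => n; rewrite /series /= big_mkord exchange_big.
have -> : 1 + \sum_z G z = \sum_z ((top == z)%:R + G z).
  rewrite [RHS]big_split /=; congr (_ + _).
  by rewrite (bigD1 top) //= eqxx big1 ?addr0 // => z; rewrite eq_sym => /negPf ->.
apply: cvg_big => [|z _]; first exact: add_continuous.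
exact: part_cvg.
Qed.

End WeightedSeries.

(** * The zeta function *)

Section ComplexPowers.
Variable R : realType.
Local Notation C := R[i].

Lemma cexpD (z w : C) : cexp (z + w) = cexp z * cexp w.
Proof.
case: z w => [a b] [a' b']; rewrite /cexp /= expRD cosD sinD.
by apply/eqP; rewrite eq_complex /=; apply/andP; split; apply/eqP; ring.
Qed.

Lemma cexp0 : cexp (0 : C) = 1.
Proof. by rewrite /cexp /= expR0 cos0 sin0 mul1r. Qed.

Lemma norm_cexp (z : C) : `|cexp z| = (expR (complex.Re z))%:C%C.
Proof.
rewrite /cexp normrM normc_def /= expr0n /= addr0 sqrtr_sqr ger0_norm ?expR_ge0 //.
by rewrite normc_def /= cos2Dsin2 sqrtr1 mulr1.
Qed.

Lemma natpow_mulrn (q k : nat) (s : C) : natpow q (- (k%:R * s)) = natpow q (- s) ^+ k.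
Proof.
elim: k => [|k IH]; first by rewrite mul0r oppr0 /natpow mul0r cexp0.
rewrite exprS -IH /natpow -cexpD; congr cexp.
by rewrite -natr1; ring.
Qed.

(** The ratio of the geometric majorant is q^(d - Re s), exhibited as a real number to use
    convergence over the reals. *)
Lemma norm_natpow_lt1 (q d : nat) (s : C) : (1 < q)%N -> d%:R < complex.Re s ->
  exists2 r : R, `|r| < 1 & `|natpow q (- s)| * (q ^ d)%:R = r%:C%C.
Proof.
move=> q1 ds; have q0 : 0 < q%:R :> R by rewrite ltr0n ltnW.
exists (expR ((d%:R - complex.Re s) * ln q%:R)).
  rewrite ger0_norm ?expR_ge0 // -[X in _ < X]expR0 ltr_expR.
  have ln_q : 0 < ln (q%:R : R) by rewrite ln_gt0 // ltr1n.
  by rewrite pmulr_llt0 ?subr_lt0.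
rewrite /natpow norm_cexp.
have -> : (q ^ d)%:R = (expR (d%:R * ln q%:R))%:C%C :> C.
  by rewrite natrX expRM_natl lnK ?posrE // rmorphXn /= rmorph_nat.
rewrite -rmorphM /= -expRD; congr ((expR _)%:C%C).
by case: (s) => a b /=; ring.
Qed.

End ComplexPowers.

Theorem corollary1p6 (R : realType) (K : fieldExtType rat) (d : nat)
    (A : {fset {vspace 'rV[K]_d}})
    (A_arr : arrangement_in fullv A)
    (L : A -> 'cV[ring_of_integers K]_d)
    (L_locus : forall H : A,
       zero_locus (map_mx (@integer_val K) (L H)) = fsval H)
    (mu : intposet fullv A -> nat)
    (o : idomainType) (o_dvr : is_compact_dvr o)
    (phi : {rmorphism ring_of_integers K -> o})
    (Fq : finFieldType) (red : {rmorphism o -> Fq})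
    (red_residue : is_residue_field red)
    (A_good : good_reduction L (red \o phi))
    (s : R[i]) :
  let q := #|{: Fq}| in
  let M := base_change phi (ask_matrix L mu) in
  (d%:R < complex.Re s -> zeta_ask_cvg M q s) /\
  (zeta_ask_cvg M q s ->
   zeta_ask M q s =
   mfHP (- (q%:R)^-1)
     (fun y : intposet fullv A =>
        natpow q (- s) *
        q%:R ^ (d%:Z - (rk y)%:Z
                - (\sum_(x : intposet fullv A | ~~ (x <= y)%O) mu x)%N%:Z))).
Proof.
move=> q M; set T := fun y => _.
have [p p_neq0 p_max] := uniformizer_exists o_dvr.1.
pose iota : {rmorphism ring_of_integers K -> K} := val.
have iota_inj : injective iota by exact: val_inj.
have L_locus' H : zero_locus (map_mx iota (L H)) = fsval H by exact: L_locus.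
pose psi : {rmorphism ring_of_integers K -> Fq} := red \o phi.
have psiE x : psi x = red (phi x) by [].
have {}A_good : good_reduction L psi by exact: A_good.
have q_gt1 : (1 < q)%N by exact: finNzRing_gt1.
pose LA := intposet fullv A.
pose b k (z : LA) := level_sum L_locus' p phi red_residue mu k z.
pose c (z : LA) : rat := q%:R ^+ \dim (flat_space z) / q%:R ^+ weight_exponent mu z.
pose sw (y z : LA) : rat := stratum_weight Fq (Some y) z.
pose top : LA := center L_locus'.
pose t : R[i] := natpow q (- s).
have q_gt0 : 0 < q%:R :> rat by rewrite ltr0n ltnW.
have c_gt0 z : 0 < c z by rewrite divr_gt0 ?exprn_gt0.
(* Up to a positive power of q, this is a number of points. *)
have sw_ge0 (y z : LA) : (z <= y)%O -> 0 <= sw y z.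
  move=> zy; have := card_stratum A_arr iota_inj L_locus' A_good zy.
  move=> /(congr1 (fun r : rat => 0 <= r)).
  by rewrite ler0n pmulr_rge0 ?exprn_gt0 // => /esym.
have top_max (z : LA) : (z <= top)%O.
  rewrite flat_leE -(common_zeros_containing L_locus' z).
  exact/common_zerosS/finset.subsetT.
have TE z : T z = t * ratr (c z).
  rewrite /T /t; congr (_ * _).
  have dz : (\dim (flat_space z) <= d)%N.
    by rewrite (leq_trans (dimvS (subvf _))) // dim_rowvf.
  have -> : d%:Z - (rk z)%:Z = (\dim (flat_space z))%:Z.
    by rewrite /rk dim_rowvf subzn ?leq_subr // subKn.
  have qN0 : q%:R != 0 :> R[i] by rewrite pnatr_eq0 -lt0n ltnW.
  rewrite expfzDr // -exprnP -exprnN -/(weight_exponent mu z).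
  by rewrite rmorphM fmorphV !rmorphXn /= !ratr_nat.
have [G [mfHP_E GE]] := mfHP_recursion A_arr Fq T.
have GE' z : G z = t * ratr (c z) / (1 - t * ratr (c z)) *
    (ratr (sw top z) + \sum_(y | (z < y)%O) ratr (sw y z) * G y).
  by rewrite GE TE /sw stratum_weight_center.
have termE : zeta_ask_term M q s = (fun k => \sum_z ratr (b k z) * t ^+ k).
  apply/funext => k; rewrite /zeta_ask_term natpow_mulrn -mulr_suml.
  congr (_ * _); rewrite -rmorph_sum; congr ratr.
  exact: (ask_level_sum A_arr iota_inj L_locus' p_neq0 p_max red_residue psiE A_good mu k).
have b0 z : b 0 z = (top == z)%:R by apply: level_sum0.
have bS k z : b k.+1 z = c z * \sum_(y | (z <= y)%O) sw y z * b k y.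
  exact: (level_sumS A_arr iota_inj L_locus' p_neq0 p_max red_residue psiE A_good).
have b_ge0 k z : 0 <= b k z by apply: level_sum_ge0.
(* Terms tending to 0 suffice for both clauses: one gets this from the geometric majorant, the other
   from the assumed convergence. *)
have cvg0 : (zeta_ask_term M q s @ \oo --> (0 : R[i]^o))%classic ->
    (series (zeta_ask_term M q s) @ \oo --> (mfHP (- (q%:R)^-1) T : R[i]^o))%classic.
  rewrite termE mfHP_E => a0.
  exact: (total_cvg top_max c_gt0 sw_ge0 (@stratum_weight_diag _ _ A Fq) b0 bS b_ge0 GE' a0).
split=> [ds|cvgM]; last first.
  apply: (@cvg_lim R[i]^o); first exact: norm_hausdorff.
  exact/cvg0/cvg_series_cvg_0.
apply: cvgP (cvg0 _).
have [r r1 rE] := norm_natpow_lt1 q_gt1 ds.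
have rk0 : ((fun k => r ^+ k) @ \oo --> (0 : R))%classic by apply: cvg_expr.
apply/cvgr0Pnorm_lt => e e0.
have eE : e = (complex.Re e)%:C%C by rewrite RRe_real // realE ltW.
have e0' : 0 < complex.Re e by move: e0; rewrite eE ltcR.
move/cvgr0Pnorm_lt: rk0 => /(_ _ e0'); apply: filterS => k rke.
rewrite termE -mulr_suml normrM -rmorph_sum /= ger0_norm; last first.
  by rewrite ler0q sumr_ge0.
apply: (@le_lt_trans _ _ ((r ^+ k)%:C%C)); last first.
  by rewrite eE ltcR; apply: le_lt_trans rke; apply: ler_norm.
rewrite rmorphXn /= -rE [X in _ <= X]exprMn mulrC normrX ler_wpM2l ?exprn_ge0 //.
rewrite -natrX -expnM -(ratr_nat _ (q ^ _)) ler_rat.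
exact: sum_level_sum_le.
Qed.
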